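(* Let $k\ge 3$ and let $n$ be the input length. Consider the $k$-party promise function $\mathrm{GP}_k$ defined on $k$-tuples of $n$-bit strings $x_1,\dots,x_k$ satisfying $|x_1\oplus\dots\oplus x_k|\notin[n/3,2n/3]$, by $\mathrm{GP}_k(x_1,\dots,x_k)=0$ if $|x_1\oplus\dots\oplus x_k|<n/2$ and $\mathrm{GP}_k(x_1,\dots,x_k)=1$ otherwise. Then: (a) Using (unrestricted) shared randomness, $\mathrm{GP}_k$ can be solved by a classical $k$-party SMP protocol of cost $k$ in which each player sends one bit. (b) For every $2\le t\le k-1$, in the $k$-party SMP model with quantum communication and $t$-shared randomness, the communication complexity of $\mathrm{GP}_k$ is $\Omega(k n^{1-t/k})$. (c) In particular, in the $k$-party SMP model with quantum communication and without shared randomness, the communication complexity of $\mathrm{GP}_k$ is $\Omega(k n^{1-2/k})$.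
   Context: For a bit string $x$, $|x|$ denotes its Hamming weight and $\oplus$ denotes bitwise XOR. The $k$-party SMP model (number-in-hand): players $A_1,\dots,A_k$, where $A_i$ receives $x_i\in\{0,1\}^n$, each send one message to a referee who computes the output; the cost is the total length of the messages (in qubits, for quantum messages, where the referee may apply any quantum measurement). A protocol solves $\mathrm{GP}_k$ if on every input satisfying the promise the referee answers correctly with probability at least $2/3$. Unrestricted shared randomness: all players see the same random string, independent of the input. $t$-shared randomness ($2\le t\le k$): for each set $S\subseteq[k]$ with $|S|=t$ there is an independent random string $R_S$ (of arbitrary length, independent of the input) known exactly to the players in $S$. Without shared randomness, players have only private randomness. *)

(* Defs.v *)
From HB Require Import structures.
From mathcomp Require Import all_boot all_order all_algebra.
From mathcomp Require Import complex.
From mathcomp Require Import reals exp.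

Set Implicit Arguments.
Unset Strict Implicit.
Unset Printing Implicit Defensive.

Import Order.TTheory GRing.Theory Num.Theory.
Local Open Scope ring_scope.

Notation bits n := {ffun 'I_n -> bool}.

Definition xorall (k n : nat) (x : 'I_k -> bits n) : bits n :=
  [ffun j => \big[addb/false]_(i < k) x i j].

Definition hw (n : nat) (z : bits n) : nat := #|[set j | z j]|.

Definition GP_promise (k n : nat) (x : 'I_k -> bits n) : Prop :=
  ~ ((n <= 3 * hw (xorall x))%N /\ (3 * hw (xorall x) <= 2 * n)%N).

Definition GP (k n : nat) (x : 'I_k -> bits n) : bool :=
  (n <= 2 * hw (xorall x))%N.

(* A protocol has, for every S \subseteq [k], an independent random   *)
(* string r S (drawn from a finite set Omega with its own distribution *)
(* pr S).  Player i may read r S iff (allowed S && i \in S), or       *)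
(* S = {i} (private randomness).  The referee reads none of them.     *)

Definition readable (k : nat) (allowed : pred {set 'I_k}) (i : 'I_k)
  (S : {set 'I_k}) : bool := (allowed S && (i \in S)) || (S == [set i]).

Definition unrestricted_shared (k : nat) : pred {set 'I_k} :=
  fun S => S == [set: 'I_k].
Definition t_shared (k t : nat) : pred {set 'I_k} :=
  fun S => #|S| == t.
Definition no_shared (k : nat) : pred {set 'I_k} := pred0.

Definition prob_rand (R : realType) (k : nat) (Omega : finType)
  (pr : {set 'I_k} -> Omega -> R) (r : {ffun {set 'I_k} -> Omega}) : R :=
  \prod_(S : {set 'I_k}) pr S (r S).

Definition distrs (R : realType) (k : nat) (Omega : finType)
  (pr : {set 'I_k} -> Omega -> R) : Prop :=
  (forall S w, 0 <= pr S w) /\ (forall S, \sum_(w : Omega) pr S w = 1).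

Record cprot (R : realType) (k n : nat) := CProt {
  c_Omega : finType;
  c_pr : {set 'I_k} -> c_Omega -> R;
  c_len : 'I_k -> nat;
  c_msg : forall i : 'I_k, bits n -> {ffun {set 'I_k} -> c_Omega} ->
          (c_len i).-tuple bool;
  (* (possibly randomized) referee: probability of answering 1 *)
  c_ref : (forall i : 'I_k, (c_len i).-tuple bool) -> R }.
Arguments c_Omega {R k n} c.
Arguments c_pr {R k n} c _ _.
Arguments c_len {R k n} c _.
Arguments c_msg {R k n} c _ _ _.
Arguments c_ref {R k n} c _.

Definition cvalid (R : realType) k n (allowed : pred {set 'I_k})
  (P : cprot R k n) : Prop :=
  distrs (c_pr P) /\
  (forall i x (r r' : {ffun {set 'I_k} -> c_Omega P}),
      (forall S, readable allowed i S -> r S = r' S) ->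
      c_msg P i x r = c_msg P i x r') /\
  (forall m, 0 <= c_ref P m <= 1).

Definition cprob_correct (R : realType) k n
  (P : cprot R k n) (x : 'I_k -> bits n) : R :=
  \sum_(r : {ffun {set 'I_k} -> c_Omega P})
     prob_rand (c_pr P) r *
     (let d := c_ref P (fun i => c_msg P i (x i) r) in
      if GP x then d else 1 - d).

Definition csolves (R : realType) k n
  (P : cprot R k n) : Prop :=
  forall x : 'I_k -> bits n, GP_promise x ->
    2%:R / 3%:R <= cprob_correct P x.

Definition ccost (R : realType) k n
  (P : cprot R k n) : nat := (\sum_(i < k) c_len P i)%N.

Definition cmat (R : realType) (T : finType) := T -> T -> R[i].

Definition psd (R : realType) (T : finType) (A : cmat R T) : Prop :=
  forall v : T -> R[i],
    0 <= \sum_(a : T) \sum_(b : T) (v a)^* * A a b * v b.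

Definition density (R : realType) (T : finType) (A : cmat R T) : Prop :=
  psd A /\ \sum_(a : T) A a a = 1.

Definition idmat (R : realType) (T : finType) : cmat R T :=
  fun a b => if a == b then 1 else 0.

(* Hilbert space of player i's message: q i qubits *)
Definition reg (k : nat) (q : 'I_k -> nat) (i : 'I_k) := 'I_(2 ^ q i).
(* joint space received by the referee: tensor product of the registers *)
Definition joint (k : nat) (q : 'I_k -> nat) :=
  {dffun forall i : 'I_k, 'I_(2 ^ q i)}.

Definition tens (R : realType) (k : nat) (q : 'I_k -> nat)
  (rho : forall i : 'I_k, 'I_(2 ^ q i) -> 'I_(2 ^ q i) -> R[i]) :
  cmat R (joint q) :=
  fun a b => \prod_(i < k) rho i (a i) (b i).

Record qprot (R : realType) (k n : nat) := QProt {
  q_Omega : finType;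
  q_pr : {set 'I_k} -> q_Omega -> R;
  q_len : 'I_k -> nat;
  q_st : forall i : 'I_k, bits n -> {ffun {set 'I_k} -> q_Omega} ->
         'I_(2 ^ q_len i) -> 'I_(2 ^ q_len i) -> R[i];
  (* referee's two-outcome POVM on the joint message space *)
  q_M : bool -> cmat R (joint q_len) }.
Arguments q_Omega {R k n} q.
Arguments q_pr {R k n} q _ _.
Arguments q_len {R k n} q _.
Arguments q_st {R k n} q _ _ _ _ _.
Arguments q_M {R k n} q _ _ _.

Definition qvalid (R : realType) k n (allowed : pred {set 'I_k})
  (P : qprot R k n) : Prop :=
  distrs (q_pr P) /\
  (forall i x r, density (q_st P i x r)) /\
  (forall i x (r r' : {ffun {set 'I_k} -> q_Omega P}),
      (forall S, readable allowed i S -> r S = r' S) ->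
      q_st P i x r = q_st P i x r') /\
  (forall b, psd (q_M P b)) /\
  (forall a c, q_M P false a c + q_M P true a c = @idmat R _ a c).

Definition qprob (R : realType) k n
  (P : qprot R k n) (x : 'I_k -> bits n) (b : bool) : R[i] :=
  \sum_(r : {ffun {set 'I_k} -> q_Omega P})
     ((prob_rand (q_pr P) r)%:C)%C *
     \sum_(a : joint (q_len P)) \sum_(c : joint (q_len P))
        q_M P b a c * tens (fun i => q_st P i (x i) r) c a.

Definition qsolves (R : realType) k n
  (P : qprot R k n) : Prop :=
  forall x : 'I_k -> bits n, GP_promise x ->
    ((2%:R / 3%:R)%:C)%C <= qprob P x (GP x).

Definition qcost (R : realType) k n
  (P : qprot R k n) : nat := (\sum_(i < k) q_len P i)%N.

(* Main.v *)
Require Import Defs.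
From HB Require Import structures.
From mathcomp Require Import all_boot all_order all_algebra.
From mathcomp Require Import complex.
From mathcomp Require Import reals exp.
From mathcomp Require Import spectral sesquilinear ring lra zify.
Import Order.TTheory GRing.Theory Num.Theory.
Local Open Scope ring_scope.

Set Implicit Arguments.
Unset Strict Implicit.
Unset Printing Implicit Defensive.

(* Upper bound: everybody sends the bit at a common random position.

   Lower bound.  Expose the input positions one after the other.  If the XOR is
   forced to be [b] on the first positions of a set [J] and left uniform
   elsewhere, forcing one further position [m] changes the acceptance probability
   by the trace of the measurement against the tensor product over the players [i]
   of the martingale differences of their messages at [m], hence by at most the
   mean of the product of the trace norms of these differences.  Any [k - 1]
   players stay independent, so Cauchy-Schwarz bounds that mean by the product of
   the L2 norms, and Finner's inequality (every random string is read by at most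
   [t] players) bounds its average over the shared randomness by
   [prod_i A_i(m)^(1/t)], where [A_i(m)] is the mean squared trace norm.

   A message of [c] qubits satisfies [sum_m A_i(m) = O(c)] (a random access code
   bound).  By duality this is a bound on a matrix martingale, which follows from
   the 2-smoothness of the Schatten norm of exponent [2^s] with [2^s] about [c].
   Averaging over [m], there is a set [J] of more than [2n/3] positions on which
   [prod_i A_i(m)] is [O(cost / (k n))^k].  The values [b = 0] and [b = 1] on [J]
   have to be told apart, so [n (cost / (k n))^(k / t)] is bounded below. *)

(** Lagrange's identity: twice the difference of the two sides is the sum over [i] and [j] of
    [w i * w j * (a i * b j - a j * b i) ^+ 2]. *)
Lemma sum_cauchy_schwarz (R : realDomainType) (I : finType) (w a b : I -> R) :
  (forall i, 0 <= w i) ->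
  (\sum_i w i * (a i * b i)) ^+ 2 <=
  (\sum_i w i * a i ^+ 2) * (\sum_i w i * b i ^+ 2).
Proof.
move=> w0; rewrite -(ler_pMn2r (n := 2)) // -subr_ge0.
have -> : (\sum_i w i * a i ^+ 2) * (\sum_i w i * b i ^+ 2) *+ 2 -
    (\sum_i w i * (a i * b i)) ^+ 2 *+ 2 =
    \sum_i \sum_j w i * w j * (a i * b j - a j * b i) ^+ 2.
  have -> : \sum_i \sum_j w i * w j * (a i * b j - a j * b i) ^+ 2 =
     \sum_i \sum_j (w i * a i ^+ 2) * (w j * b j ^+ 2) +
     \sum_i \sum_j (w j * a j ^+ 2) * (w i * b i ^+ 2) -
     \sum_i \sum_j (w i * (a i * b i)) * (w j * (a j * b j)) *+ 2.
    rewrite -!big_split -sumrB; apply: eq_bigr => i _.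
    rewrite -!big_split -sumrB; apply: eq_bigr => j _ /=.
    rewrite mulr2n; ring.
  rewrite [\sum_i \sum_j w j * _ * _]exchange_big /= expr2 !big_distrlr /= -mulr2n.
  congr (_ - _).
  by rewrite -sumrMnl; apply: eq_bigr => i _; rewrite sumrMnl.
by do 2 (apply: sumr_ge0 => ? _); rewrite mulr_ge0 ?sqr_ge0 ?mulr_ge0.
Qed.

(** * Schatten norms *)

Section Schatten.
Variable R : rcfType.
Local Open Scope sesquilinear_scope.

Definition herm d (A : 'M[R[i]]_d) := A^t* = A.

Definition rtr d (A : 'M[R[i]]_d) : R := complex.Re (\tr A).

Definition normsq (z : R[i]) : R := complex.Re z ^+ 2 + complex.Im z ^+ 2.

(* The Schatten norm of exponent [2 ^ s.+1], for Hermitian arguments. *)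
Fixpoint schatten s d (A : 'M[R[i]]_d) : R :=
  if s is s'.+1 then Num.sqrt (schatten s' (A *m A))
  else Num.sqrt (rtr (A *m A)).

Lemma ReD (x y : R[i]) : complex.Re (x + y) = complex.Re x + complex.Re y.
Proof. by case: x y => [a b] [c e]. Qed.

Lemma Re_sum (I : finType) (F : I -> R[i]) :
  complex.Re (\sum_i F i) = \sum_i complex.Re (F i).
Proof. by apply: (big_morph _ ReD). Qed.

Lemma ReZ (a : R) (x : R[i]) : complex.Re (a%:C%C * x) = a * complex.Re x.
Proof. by case: x => [b c] /=; rewrite mul0r subr0. Qed.

Lemma ReE (x y : R[i]) : complex.Re (x * y) =
  complex.Re x * complex.Re y - complex.Im x * complex.Im y.
Proof. by case: x y => [a b] [c e]. Qed.

Lemma Re_conj (x : R[i]) : complex.Re (x^*) = complex.Re x.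
Proof. by case: x. Qed.

Lemma Im_conj (x : R[i]) : complex.Im (x^*) = - complex.Im x.
Proof. by case: x. Qed.

Lemma rtrE d (A : 'M[R[i]]_d) : rtr A = \sum_i complex.Re (A i i).
Proof. exact: Re_sum. Qed.

Lemma rtrD d (A B : 'M[R[i]]_d) : rtr (A + B) = rtr A + rtr B.
Proof. by rewrite /rtr mxtraceD ReD. Qed.

Lemma rtrZ d a (A : 'M[R[i]]_d) : rtr (a%:C%C *: A) = a * rtr A.
Proof. by rewrite /rtr mxtraceZ ReZ. Qed.

Lemma rtrC d (A B : 'M[R[i]]_d) : rtr (A *m B) = rtr (B *m A).
Proof. by rewrite /rtr mxtrace_mulC. Qed.

Lemma hermE {d} {A : 'M[R[i]]_d} : herm A -> forall i j, A i j = (A j i)^*.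
Proof. by move=> hA i j; rewrite -{1}hA !mxE. Qed.

Lemma hermD d (A B : 'M[R[i]]_d) : herm A -> herm B -> herm (A + B).
Proof. by rewrite /herm linearD /= map_mxD => -> ->. Qed.

Lemma herm_sqr d (A : 'M[R[i]]_d) : herm A -> herm (A *m A).
Proof. by rewrite /herm trmx_mul map_mxM => ->. Qed.

Lemma herm_anticomm d (A B : 'M[R[i]]_d) :
  herm A -> herm B -> herm (A *m B + B *m A).
Proof.
move=> hA hB; rewrite /herm linearD /= map_mxD !trmx_mul !map_mxM hA hB.
by rewrite addrC.
Qed.

Lemma hermZ d (a : R) (A : 'M[R[i]]_d) : herm A -> herm (a%:C%C *: A).
Proof.
move=> hA; apply/matrixP => i j; rewrite !mxE rmorphM /= (hermE hA i j).
by congr (_ * _); apply/eqP; rewrite eq_complex /= oppr0 !eqxx.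
Qed.

Lemma herm_conj d (P A : 'M[R[i]]_d) : herm A -> herm (P *m A *m P^t*).
Proof. by move=> hA; rewrite /herm !trmx_mul !map_mxM trmxCK hA mulmxA. Qed.

Lemma rtr_conj d (P A : 'M[R[i]]_d) : P^t* *m P = 1%:M ->
  rtr (P *m A *m P^t*) = rtr A.
Proof. by move=> PP; rewrite rtrC mulmxA PP mul1mx. Qed.

Lemma conj_mul d (P A B : 'M[R[i]]_d) : P^t* *m P = 1%:M ->
  (P *m A *m P^t*) *m (P *m B *m P^t*) = P *m (A *m B) *m P^t*.
Proof.
move=> PP; rewrite !mulmxA -(mulmxA (P *m A)) PP mulmx1 //.
Qed.

Lemma schatten_conj s d (P A : 'M[R[i]]_d) : P^t* *m P = 1%:M ->
  schatten s (P *m A *m P^t*) = schatten s A.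
Proof.
move=> PP; elim: s A => [|s IH] A /=; rewrite conj_mul //.
  by rewrite rtr_conj.
by rewrite IH.
Qed.

Lemma diag_sqr d (A : 'M[R[i]]_d) i : herm A ->
  complex.Re ((A *m A) i i) = \sum_j normsq (A i j).
Proof.
move=> hA; rewrite mxE Re_sum; apply: eq_bigr => j _.
rewrite (hermE hA j i) ReE Re_conj Im_conj /normsq; ring.
Qed.

Lemma diag_sqr_ge d (A : 'M[R[i]]_d) i : herm A ->
  complex.Re (A i i) ^+ 2 <= complex.Re ((A *m A) i i).
Proof.
move=> hA; rewrite diag_sqr // (bigD1 i) //= {1}/normsq -addrA lerDl.
rewrite addr_ge0 ?sqr_ge0 //; apply: sumr_ge0 => j _.
by rewrite addr_ge0 ?sqr_ge0.
Qed.

Lemma diag_sqr_ge0 d (A : 'M[R[i]]_d) i : herm A ->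
  0 <= complex.Re ((A *m A) i i).
Proof. by move=> hA; apply: le_trans (diag_sqr_ge i hA); rewrite sqr_ge0. Qed.

Lemma rtr_sqr_ge0 d (A : 'M[R[i]]_d) : herm A -> 0 <= rtr (A *m A).
Proof. by move=> hA; rewrite rtrE sumr_ge0 // => i _; apply: diag_sqr_ge0. Qed.

Lemma schatten_ge0 s d (A : 'M[R[i]]_d) : 0 <= schatten s A.
Proof. by case: s => [|s]; apply: sqrtr_ge0. Qed.

Lemma schattenS s d (A : 'M[R[i]]_d) :
  schatten s.+1 A ^+ 2 = schatten s (A *m A).
Proof. by rewrite /= sqr_sqrtr // schatten_ge0. Qed.

Lemma schatten0 d (A : 'M[R[i]]_d) : herm A ->
  schatten 0 A ^+ 2 = rtr (A *m A).
Proof. by move=> hA; rewrite /= sqr_sqrtr // rtr_sqr_ge0. Qed.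

Lemma exp2S (x : R) s : x ^+ (2 ^ s.+1) = (x ^+ 2) ^+ (2 ^ s).
Proof. by rewrite expnS exprM. Qed.

(** Pinching. The induction passes to [A *m A], whose diagonal entries dominate the squares of those
    of [A]. *)
Lemma diag_schatten s d (A : 'M[R[i]]_d) : herm A ->
  \sum_i complex.Re (A i i) ^+ (2 ^ s.+1) <= schatten s A ^+ (2 ^ s.+1).
Proof.
elim: s A => [|s IH] A hA.
  by rewrite schatten0 // rtrE ler_sum // => i _; apply: diag_sqr_ge.
rewrite exp2S schattenS; apply: le_trans (IH _ (herm_sqr hA)).
apply: ler_sum => i _; rewrite exp2S lerXn2r ?nnegrE ?sqr_ge0 //.
  exact: diag_sqr_ge0.
exact: diag_sqr_ge.
Qed.

Definition Cdiag d (l : 'rV[R]_d) := diag_mx (map_mx (real_complex R) l).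

Lemma Cdiag_sqr d (l : 'rV[R]_d) :
  Cdiag l *m Cdiag l = Cdiag (\row_i l 0 i ^+ 2).
Proof.
rewrite mulmx_diag; congr diag_mx; apply/rowP => i; rewrite !mxE.
by rewrite expr2 rmorphM.
Qed.

Lemma rtr_Cdiag d (l : 'rV[R]_d) : rtr (Cdiag l) = \sum_i l 0 i.
Proof. by rewrite rtrE; apply: eq_bigr => i _; rewrite !mxE eqxx. Qed.

Lemma schatten_diag s d (l : 'rV[R]_d) :
  schatten s (Cdiag l) ^+ (2 ^ s.+1) =
  \sum_i l 0 i ^+ (2 ^ s.+1).
Proof.
elim: s l => [|s IH] l.
  rewrite [schatten 0 _]/= Cdiag_sqr rtr_Cdiag sqr_sqrtr.
    by apply: eq_bigr => i _; rewrite mxE.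
  by apply: sumr_ge0 => i _; rewrite mxE sqr_ge0.
rewrite exp2S schattenS Cdiag_sqr IH; apply: eq_bigr => i _.
by rewrite mxE -exp2S.
Qed.

Definition eigvals d (A : 'M[R[i]]_d) : 'rV[R]_d :=
  map_mx (@complex.Re R) (spectral_diag A).

Lemma spectral_mul d (A : 'M[R[i]]_d) :
  spectralmx A *m (spectralmx A)^t* = 1%:M.
Proof. exact/unitarymxP/spectral_unitarymx. Qed.

Lemma spectral_mulC d (A : 'M[R[i]]_d) :
  (spectralmx A)^t* *m spectralmx A = 1%:M.
Proof. exact/mulmx1C/spectral_mul. Qed.

Lemma spectral_herm d (A : 'M[R[i]]_d) : herm A ->
  A = (spectralmx A)^t* *m Cdiag (eigvals A) *m spectralmx A.
Proof.
move=> hA; have hA' : A \is hermsymmx.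
  by apply/is_hermitianmxP; rewrite expr0 scale1r hA.
rewrite -(invmx_unitary (spectral_unitarymx A)).
have {1}-> := orthomx_spectralP (hermitian_normalmx hA').
congr (_ *m diag_mx _ *m _); apply/rowP => i; rewrite !mxE.
have /mxOverP/(_ 0 i) := hermitian_spectral_diag_real hA'.
by move/complex_realP => [k ->].
Qed.

(** A Hölder inequality. The anticommutator, unlike [X *m Y], is again Hermitian. In its eigenbasis
    the eigenvalues are diagonal entries, which Cauchy-Schwarz bounds by those of [X *m X] and
    [Y *m Y]; pinching returns to the norms. *)
Lemma schatten_anticomm s d (X Y : 'M[R[i]]_d) : herm X -> herm Y ->
  schatten s (X *m Y + Y *m X) <= 2 * (schatten s.+1 X * schatten s.+1 Y).
Proof.
move=> hX hY.
have E := spectral_herm (herm_anticomm hX hY).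
have PP := spectral_mulC (X *m Y + Y *m X).
have PP' := spectral_mul (X *m Y + Y *m X).
move: (spectralmx _) (eigvals _) PP PP' E => P l PP PP' E.
set B := Cdiag _ in E.
have EB : (P *m X *m P^t*) *m (P *m Y *m P^t*) +
          (P *m Y *m P^t*) *m (P *m X *m P^t*) = B.
  rewrite !conj_mul // -mulmxDl -mulmxDr E !mulmxA PP' mul1mx -mulmxA PP'.
  by rewrite mulmx1.
rewrite -(schatten_conj s _ PP) -(schatten_conj s.+1 X PP).
rewrite -(schatten_conj s.+1 Y PP) mulmxDr mulmxDl -!(conj_mul _ _ PP).
(* From here on [X] and [Y] are written in the eigenbasis, where their anticommutator is the
   diagonal matrix [B]. *)
move: EB (herm_conj P hX) (herm_conj P hY).
move: (P *m X *m _) (P *m Y *m _) => {hX hY E PP PP'} {}X {}Y EB hX hY.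
rewrite EB -(@ler_pXn2r _ (2 ^ s.+1)) ?nnegrE ?expn_gt0 //; last 2 first.
- exact: schatten_ge0.
- by rewrite !mulr_ge0 // schatten_ge0.
rewrite schatten_diag.
have lE i : l 0 i = 2 * \sum_j (complex.Re (X i j) * complex.Re (Y i j) +
                                complex.Im (X i j) * complex.Im (Y i j)).
  have := congr1 (fun M : 'M__ => complex.Re (M i i)) EB.
  rewrite !mxE eqxx /= => <-; rewrite ReD !Re_sum -big_split mulr_sumr /=.
  apply: eq_bigr => j _; rewrite (hermE hX j i) (hermE hY j i) !ReE.
  rewrite !Re_conj !Im_conj; ring.
have lB i : l 0 i ^+ 2 <= 4 * (complex.Re ((X *m X) i i) *
                               complex.Re ((Y *m Y) i i)).
  rewrite lE exprMn -natrX ler_wpM2l // !diag_sqr //.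
  pose f (M : 'M[R[i]]_d) (p : 'I_d + 'I_d) := match p with
    inl j => complex.Re (M i j) | inr j => complex.Im (M i j) end.
  have := @sum_cauchy_schwarz R _ (fun=> 1) (f X) (f Y) (fun=> ler01).
  by rewrite !big_sumType /= !(eq_bigr _ (fun _ _ => mul1r _)) -!big_split.
apply: (@le_trans _ _ (\sum_i 2 ^+ (2 ^ s.+1) *
   (complex.Re ((X *m X) i i) ^+ (2 ^ s) *
    complex.Re ((Y *m Y) i i) ^+ (2 ^ s)))).
  apply: ler_sum => i _; rewrite !exp2S -!exprMn -natrX lerXn2r ?nnegrE //.
    by rewrite sqr_ge0.
  by rewrite !mulr_ge0 // diag_sqr_ge0.
rewrite -mulr_sumr exprMn ler_wpM2l ?exprn_ge0 //.
(* A second Cauchy-Schwarz, over the index of the eigenbasis, separates [X] from [Y]. *)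
rewrite -(@ler_pXn2r _ 2) ?nnegrE //; last 2 first.
- by apply: sumr_ge0 => i _; rewrite mulr_ge0 // exprn_ge0 // diag_sqr_ge0.
- by rewrite exprn_ge0 // mulr_ge0 // schatten_ge0.
rewrite exprMn exprMn.
have := @sum_cauchy_schwarz R _ (fun=> 1)
  (fun i => complex.Re ((X *m X) i i) ^+ (2 ^ s))
  (fun i => complex.Re ((Y *m Y) i i) ^+ (2 ^ s)) (fun=> ler01).
rewrite !(eq_bigr _ (fun _ _ => mul1r _)) => /le_trans; apply.
have h (M : 'M[R[i]]_d) : herm M ->
    \sum_i (complex.Re ((M *m M) i i) ^+ (2 ^ s)) ^+ 2 <=
    (schatten s.+1 M ^+ (2 ^ s.+1)) ^+ 2.
  move=> hM; rewrite [leRHS]exprAC schattenS.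
  apply: le_trans (diag_schatten s (herm_sqr hM)).
  by apply: ler_sum => i _; rewrite exprAC -exp2S.
apply: ler_pM; rewrite ?h // sumr_ge0 // => i _; rewrite sqr_ge0 //.
Qed.

Lemma mulmx_sqrD d (X Y : 'M[R[i]]_d) : (X + Y) *m (X + Y) =
  (X *m X + Y *m Y) + (X *m Y + Y *m X).
Proof. by rewrite mulmxDl !mulmxDr [Y *m X + _]addrC addrACA. Qed.

(** Cauchy-Schwarz for the Hilbert-Schmidt inner product, with the real and imaginary parts of the
    entries as coordinates. *)
Lemma rtr_mul_schatten0 d (X Y : 'M[R[i]]_d) : herm X -> herm Y ->
  rtr (X *m Y) <= schatten 0 X * schatten 0 Y.
Proof.
move=> hX hY; apply: le_trans (ler_norm _) _.
rewrite -(@ler_pXn2r _ 2) ?nnegrE ?mulr_ge0 ?schatten_ge0 //.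
rewrite real_normK ?num_real // exprMn !schatten0 //.
pose f (M : 'M[R[i]]_d) (p : 'I_d * 'I_d + 'I_d * 'I_d) := match p with
  inl p => complex.Re (M p.1 p.2) | inr p => complex.Im (M p.1 p.2) end.
have := @sum_cauchy_schwarz R _ (fun=> 1) (f X) (f Y) (fun=> ler01).
have E (M N : 'M[R[i]]_d) : herm N ->
    rtr (M *m N) = \sum_p 1 * (f M p * f N p).
  move=> hN; rewrite (eq_bigr _ (fun _ _ => mul1r _)) big_sumType /=.
  rewrite -big_split /= rtrE.
  rewrite -(pair_bigA _ (fun i j => complex.Re (M i j) * complex.Re (N i j) +
    complex.Im (M i j) * complex.Im (N i j))).
  apply: eq_bigr => i _; rewrite mxE Re_sum; apply: eq_bigr => j _.
  by rewrite (hermE hN j i) ReE Re_conj Im_conj mulrN opprK.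
by rewrite !E.
Qed.

(** At exponent 2q the square of the left side is the norm at exponent q of (X^2 + Y^2) + (XY + YX).
    The induction hypothesis and [schatten_anticomm] bound it by the square of the right side. *)
Lemma schattenD s d (X Y : 'M[R[i]]_d) : herm X -> herm Y ->
  schatten s (X + Y) <= schatten s X + schatten s Y.
Proof.
elim: s X Y => [|s IH] X Y hX hY;
  rewrite -(@ler_pXn2r _ 2) ?nnegrE ?addr_ge0 ?schatten_ge0 //.
  have hXY := hermD hX hY; rewrite sqrrD !schatten0 // mulmx_sqrD !rtrD (rtrC Y X).
  by have := rtr_mul_schatten0 hX hY; lra.
rewrite sqrrD !schattenS mulmx_sqrD.
have hX2 := herm_sqr hX; have hY2 := herm_sqr hY.
have := IH _ _ (hermD hX2 hY2) (herm_anticomm hX hY).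
have := IH _ _ hX2 hY2; have := schatten_anticomm s hX hY.
by rewrite [2 * (_ * _)]mulr_natl; lra.
Qed.

Lemma hermN d (X : 'M[R[i]]_d) : herm X -> herm (- X).
Proof. by rewrite /herm linearN map_mxN => ->. Qed.

End Schatten.

Section SchattenSmooth.
Variable R : rcfType.
Local Open Scope sesquilinear_scope.

(* Passing from [(X, Y)] at exponent [2q] to [(X^2 + Y^2, XY + YX)] at exponent
   [q] turns the constant [K] into [1 + 2K], so that [K = q - 1]. *)
Lemma schatten_smooth s d (X Y : 'M[R[i]]_d) : herm X -> herm Y ->
  schatten s (X + Y) ^+ 2 + schatten s (X - Y) ^+ 2 <=
  2 * (schatten s X ^+ 2 + ((2 ^ s.+1)%:R - 1) * schatten s Y ^+ 2).
Proof.
elim: s X Y => [|s IH] X Y hX hY; have hN := hermN hY.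
  (* Exponent 2 is the parallelogram law, with constant 2 - 1. *)
  have hp := hermD hX hY; have hm := hermD hX hN.
  rewrite !schatten0 // !mulmx_sqrD !rtrD !mulmxN !mulNmx opprK.
  by rewrite /rtr !raddfN /=; lra.
rewrite !schattenS !mulmx_sqrD mulmxN !mulNmx mulmxN opprK -opprD.
have hX2 := herm_sqr hX; have hY2 := herm_sqr hY.
have hb := herm_anticomm hX hY.
have := IH _ _ (hermD hX2 hY2) hb.
have ha := schattenD s hX2 hY2; have hb' := schatten_anticomm s hX hY.
move: ha hb'; rewrite -!schattenS.
have a0 := schatten_ge0 s (X *m X + Y *m Y).
have b0 := schatten_ge0 s (X *m Y + Y *m X).
have u0 := schatten_ge0 s (X *m X + Y *m Y + (X *m Y + Y *m X)).
have v0 := schatten_ge0 s (X *m X + Y *m Y - (X *m Y + Y *m X)).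
have x0 := schatten_ge0 s.+1 X; have y0 := schatten_ge0 s.+1 Y.
rewrite (expnS 2 s.+1) natrM.
have : 1 <= (2 ^ s.+1)%:R :> R by rewrite ler1n expn_gt0.
move: a0 b0 u0 v0 x0 y0.
set x := schatten s.+1 X; set y := schatten s.+1 Y.
set a := schatten s (X *m X + Y *m Y).
set b := schatten s (X *m Y + Y *m X).
set u := schatten s (_ + _ + _); set v := schatten s (_ - _).
(* Only real numbers remain: [x] and [y] are norms at the doubled exponent, [u] and [v] are the
   squared norms of [X + Y] and [X - Y], and [q] will be the old exponent. *)
move: x y a b u v => x y a b u v a0 b0 u0 v0 x0 y0.
move: (_%:R) => q q1 hax hbx huv.
have ha2 : a ^+ 2 <= (x ^+ 2 + y ^+ 2) ^+ 2.
  by rewrite lerXn2r ?nnegrE ?addr_ge0 ?sqr_ge0 //; lra.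
have hb2 : b ^+ 2 <= (2 * (x * y)) ^+ 2.
  by rewrite lerXn2r ?nnegrE ?mulr_ge0 //; lra.
have : (q - 1) * b ^+ 2 <= (q - 1) * (2 * (x * y)) ^+ 2.
  by rewrite ler_wpM2l // subr_ge0.
move=> hqb.
have k0 : 0 <= x ^+ 2 + (2 * q - 1) * y ^+ 2.
  by rewrite addr_ge0 ?sqr_ge0 // mulr_ge0 ?sqr_ge0 //; lra.
have k1 : 0 <= 2 * (x ^+ 2 + (2 * q - 1) * y ^+ 2) by rewrite mulr_ge0.
have k2 : 0 <= u + v by rewrite addr_ge0.
rewrite -(@ler_pXn2r _ 2) //.
have h1 : (u + v) ^+ 2 <= 2 * (u ^+ 2 + v ^+ 2).
  by have := sqr_ge0 (u - v); nra.
apply: le_trans h1 _.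
(* This term is the slack left over by the new constant [2 * q - 1]. *)
have h2 : 0 <= (q - 1) * (q * (y ^+ 2) ^+ 2).
  by rewrite mulr_ge0 ?subr_ge0 // mulr_ge0 ?sqr_ge0 //; lra.
have E : (2 * (x ^+ 2 + (2 * q - 1) * y ^+ 2)) ^+ 2 =
  4 * ((x ^+ 2 + y ^+ 2) ^+ 2 + (q - 1) * (2 * (x * y)) ^+ 2) +
  16 * ((q - 1) * (q * (y ^+ 2) ^+ 2)) by ring.
rewrite E; lra.
Qed.

End SchattenSmooth.

(** * Trace norm and density matrices *)

Section TraceNorm.
Variable R : rcfType.
Local Open Scope sesquilinear_scope.

(** Encoded by a unitary diagonalization whose spectrum is a probability vector; [psd_density]
    derives this form from positivity and unit trace. *)
Definition is_density d (A : 'M[R[i]]_d) := exists (P : 'M[R[i]]_d) (p : 'rV[R]_d),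
  [/\ P^t* *m P = 1%:M, A = P^t* *m Cdiag p *m P,
      forall i, 0 <= p 0 i & \sum_i p 0 i = 1].

Lemma rtr_density d (A X : 'M[R[i]]_d) (P : 'M[R[i]]_d) (p : 'rV[R]_d) :
  A = P^t* *m Cdiag p *m P ->
  rtr (A *m X) = \sum_i p 0 i * complex.Re ((P *m X *m P^t*) i i).
Proof.
move=> ->; rewrite -!mulmxA rtrC -!mulmxA rtrE; apply: eq_bigr => i _.
by rewrite mul_diag_mx mxE [map_mx _ _ _ _]mxE ReZ !mulmxA.
Qed.

(** The observable [X] has nonnegative variance in the state [A]: in the eigenbasis of [A] this is
    Cauchy-Schwarz for the weights [p], followed by [diag_sqr_ge]. *)
Lemma rtr_density_sqr d (A X : 'M[R[i]]_d) : is_density A -> herm X ->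
  rtr (A *m X) ^+ 2 <= rtr (A *m (X *m X)).
Proof.
move=> [P [p [PP E p0 p1]]] hX; rewrite !(rtr_density _ E).
have := @sum_cauchy_schwarz R _ (p 0) (fun=> 1)
  (fun i => complex.Re ((P *m X *m P^t*) i i)) p0.
under eq_bigr do rewrite mul1r.
have E1 : \sum_i p 0 i * 1 ^+ 2 = 1.
  by rewrite -[RHS]p1; apply: eq_bigr => i _; rewrite expr1n mulr1.
rewrite E1 mul1r => /le_trans; apply; apply: ler_sum => i _.
by rewrite ler_wpM2l // -conj_mul // diag_sqr_ge //; apply: herm_conj.
Qed.

Lemma rtr_density_le d (A X : 'M[R[i]]_d) : is_density A -> herm X ->
  rtr (A *m (X *m X)) <= rtr (X *m X).
Proof.
move=> [P [p [PP E p0 p1]]] hX; rewrite !(rtr_density _ E).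
rewrite -(rtr_conj (X *m X) PP) rtrE; apply: ler_sum => i _.
rewrite ler_piMl -?conj_mul ?diag_sqr_ge0 //; last first.
  by rewrite -p1 (bigD1 i) //= lerDl sumr_ge0.
exact: herm_conj.
Qed.

(** Duality between states and Schatten norms. Repeated squaring by [rtr_density_sqr] ends at
    exponent 2, where it suffices that the eigenvalues of [A] are at most 1. *)
Lemma rtr_density_schatten s d (A X : 'M[R[i]]_d) : is_density A -> herm X ->
  rtr (A *m X) <= schatten s X.
Proof.
move=> hA hX; apply: le_trans (ler_norm _) _.
rewrite -(@ler_pXn2r _ 2) ?nnegrE ?schatten_ge0 // real_normK ?num_real //.
apply: le_trans (rtr_density_sqr hA hX) _.
elim: s X hX => [|s IH] X hX.
  by rewrite schatten0 // rtr_density_le.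
have hX2 := herm_sqr hX.
rewrite schattenS -(@ler_pXn2r _ 2) ?nnegrE ?schatten_ge0 //; last first.
  by apply: le_trans (rtr_density_sqr hA hX); rewrite sqr_ge0.
by apply: le_trans (IH _ hX2); apply: rtr_density_sqr.
Qed.

Definition trnorm d (A : 'M[R[i]]_d) : R := \sum_i `|eigvals A 0 i|.

(** The eigenvalue 0 gets the sign 1, so that the matrix is an involution. For Hermitian [A],
    pairing with it attains the trace norm. *)
Definition sgnmx d (A : 'M[R[i]]_d) : 'M[R[i]]_d :=
  (spectralmx A)^t* *m
  Cdiag (\row_i (if eigvals A 0 i < 0 then -1 else 1)) *m spectralmx A.

Lemma Cdiag_herm d (l : 'rV[R]_d) : herm (Cdiag l).
Proof.
apply/matrixP => i j; rewrite !mxE (eq_sym j i).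
have [->|ne] := eqVneq i j; last by rewrite !mulr0n rmorph0.
by rewrite !mulr1n; apply/eqP; rewrite eq_complex /= oppr0 !eqxx.
Qed.

Lemma sgnmx_herm d (A : 'M[R[i]]_d) : herm (sgnmx A).
Proof.
rewrite /sgnmx -{2}[spectralmx A]trmxCK; apply: herm_conj; exact: Cdiag_herm.
Qed.

Lemma sgnmx_sqr d (A : 'M[R[i]]_d) : sgnmx A *m sgnmx A = 1%:M.
Proof.
rewrite /sgnmx -!mulmxA (mulmxA (spectralmx A)) spectral_mul mul1mx.
rewrite (mulmxA (Cdiag _)) Cdiag_sqr.
rewrite (_ : Cdiag _ = 1%:M) ?mul1mx ?spectral_mulC //.
apply/matrixP => i j; rewrite !mxE; case: (_ < 0); rewrite ?sqrrN expr1n //.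
Qed.

Lemma rtr_sgnmx d (A : 'M[R[i]]_d) : herm A -> rtr (A *m sgnmx A) = trnorm A.
Proof.
move=> hA; rewrite (rtr_density _ (spectral_herm hA)) /sgnmx.
apply: eq_bigr => i _; rewrite !mulmxA spectral_mul mul1mx -mulmxA.
rewrite spectral_mul mulmx1 !mxE eqxx mulr1n /=.
by case: ltP => h; [rewrite ltr0_norm // mulrN1 | rewrite ger0_norm // mulr1].
Qed.

Lemma trnorm_ge0 d (A : 'M[R[i]]_d) : 0 <= trnorm A.
Proof. by apply: sumr_ge0. Qed.

Lemma rtr_density_sgnmx d (A B : 'M[R[i]]_d) : is_density A ->
  `|rtr (A *m sgnmx B)| <= 1.
Proof.
move=> hA; rewrite -(@ler_pXn2r _ 2) ?nnegrE // real_normK ?num_real //.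
apply: le_trans (rtr_density_sqr hA (sgnmx_herm B)) _.
case: hA => P [p [PP -> p0 p1]]; rewrite sgnmx_sqr mulmx1 -mulmxA rtrC -mulmxA.
by rewrite (mulmx1C PP) mulmx1 rtr_Cdiag p1 expr1n.
Qed.

(** The square of the matrix is scalar, so the norm is [a] times the root of order [2 ^ s.+1] of
    [d]; the exponent is large enough for this root to be at most 2. *)
Lemma schatten_sgnmx s d a (A : 'M[R[i]]_d) : 0 <= a -> (d <= 2 ^ (2 ^ s.+1))%N ->
  schatten s (a%:C%C *: sgnmx A) <= 2 * a.
Proof.
move=> a0 hd; rewrite -(@ler_pXn2r _ (2 ^ s.+1)) ?nnegrE ?expn_gt0 //;
  [|exact: schatten_ge0|by rewrite mulr_ge0].
have sq : (a%:C%C *: sgnmx A) *m (a%:C%C *: sgnmx A) = Cdiag (const_mx (a ^+ 2)).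
  rewrite -scalemxAl -scalemxAr sgnmx_sqr scalerA.
  apply/matrixP => i j; rewrite !mxE -rmorphM -expr2.
  by case: eqP => _; rewrite ?mulr1n ?mulr0n ?mulr1 ?mulr0.
have -> : schatten s (a%:C%C *: sgnmx A) ^+ (2 ^ s.+1) = a ^+ (2 ^ s.+1) *+ d.
  case: s hd => [|s] hd.
    rewrite schatten0; last exact/hermZ/sgnmx_herm.
    rewrite sq rtr_Cdiag; under eq_bigr do rewrite mxE.
    by rewrite sumr_const card_ord.
  rewrite exp2S schattenS sq schatten_diag; under eq_bigr do rewrite mxE.
  by rewrite sumr_const card_ord -exp2S.
rewrite exprMn -mulr_natl ler_wpM2r ?exprn_ge0 // -natrX ler_nat //.
Qed.

Lemma herm_entry d (A : 'M[R[i]]_d) : herm A -> forall i j, A i j =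
  \sum_m (eigvals A 0 m)%:C%C * ((spectralmx A m i)^* * spectralmx A m j).
Proof.
move=> hA i j; rewrite {1}(spectral_herm hA) -mulmxA mxE; apply: eq_bigr => m _.
rewrite mul_diag_mx !mxE; ring.
Qed.

(** Polarization: the form is real at x e_a + y e_b, hence so is its cross term. The choices (1, 1)
    and (1, i) for (x, y) compare the two entries. *)
Lemma psd_herm (T : finType) (A : T -> T -> R[i]) :
  (forall v : T -> R[i], 0 <= \sum_a \sum_b (v a)^* * A a b * v b) ->
  forall a b, A a b = (A b a)^*.
Proof.
move=> hA a b.
pose B (u w : T -> R[i]) := \sum_a \sum_b (u a)^* * A a b * w b.
pose dl x a : T -> R[i] := fun c => x *+ (c == a).
have Bdl x y c e : B (dl x c) (dl y e) = x^* * A c e * y.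
  rewrite /B (bigD1 c) //= (bigD1 e) //= /dl !eqxx !mulr1n.
  rewrite big1 ?big1 ?addr0 //.
    move=> f /negbTE nf; rewrite big1 // => g _.
    by rewrite nf mulr0n rmorph0 !mul0r.
  by move=> f /negbTE nf; rewrite nf mulr0n mulr0.
have BD u w : B (fun c => u c + w c) (fun c => u c + w c) =
    B u u + B w w + (B u w + B w u).
  rewrite /B -!big_split; apply: eq_bigr => c _; rewrite -!big_split.
  apply: eq_bigr => e _; rewrite /= rmorphD; ring.
have key x y : complex.Im (x^* * A a b * y + y^* * A b a * x) = 0.
  have ha : complex.Im (B (dl x a) (dl x a)) = 0.
    by move: (hA (dl x a)); rewrite -/(B _ _) lecE => /andP[/eqP].
  have hb : complex.Im (B (dl y b) (dl y b)) = 0.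
    by move: (hA (dl y b)); rewrite -/(B _ _) lecE => /andP[/eqP].
  have := hA (fun c => dl x a c + dl y b c).
  rewrite -/(B _ _) BD !Bdl lecE => /andP[/eqP].
  rewrite !Bdl in ha hb.
  have ImD (z t : R[i]) : complex.Im (z + t) = complex.Im z + complex.Im t.
    by case: z; case: t.
  by rewrite ImD ImD ha hb !add0r.
move: (key 1 1) (key 1 'i%C); case: (A a b) => p q; case: (A b a) => r t /=.
rewrite !(oppr0, mulr0, mul0r, mul1r, mulr1, subr0, sub0r, addr0, add0r, mulrN, mulNr).
by move=> h1 h2; apply/eqP; rewrite eq_complex /=; apply/andP; split; apply/eqP; lra.
Qed.

Lemma psd_density d (A : 'M[R[i]]_d) :
  (forall v : 'I_d -> R[i], 0 <= \sum_a \sum_b (v a)^* * A a b * v b) ->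
  \tr A = 1 -> is_density A.
Proof.
move=> hA trA; have hh : herm A.
  by apply/matrixP => i j; rewrite !mxE -(psd_herm hA).
have E := spectral_herm hh.
exists (spectralmx A), (eigvals A); split=> //; first exact: spectral_mulC.
  move=> m; have := hA (fun i => (spectralmx A m i)^*).
  rewrite (_ : \sum_a _ = (eigvals A 0 m)%:C%C) ?ler0c //.
  transitivity ((spectralmx A *m A *m (spectralmx A)^t*) m m).
    rewrite mxE exchange_big; apply: eq_bigr => j _; rewrite !mxE mulr_suml.
    by apply: eq_bigr => i _; rewrite conjCK.
  rewrite {2}E !mulmxA spectral_mul mul1mx -mulmxA spectral_mul mulmx1.
  by rewrite !mxE eqxx.
have : rtr A = 1 by rewrite /rtr trA.
by rewrite {1}E rtrC mulmxA spectral_mul mul1mx rtr_Cdiag.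
Qed.

End TraceNorm.

(** * Random access codes *)

(** The map from (x, y) to (h x y, h y x) is an involution of pairs. For [mixp] this says that two
    independent uniform strings stay so when they exchange their tails. *)
Lemma sum_swap (V : nmodType) (T : finType) (h : T -> T -> T) (F : T -> T -> V) :
  (forall x y, h (h x y) (h y x) = x) ->
  \sum_x \sum_y F (h x y) (h y x) = \sum_x \sum_y F x y.
Proof.
move=> hK; rewrite !pair_bigA /=.
rewrite [RHS](reindex_inj (h := fun p : T * T => (h p.1 p.2, h p.2 p.1))) //=.
by apply: (can_inj (g := fun p : T * T => (h p.1 p.2, h p.2 p.1))) => -[x y] /=;
  rewrite !hK.
Qed.

Lemma sum_swap_l (V : nmodType) (T : finType) (h : T -> T -> T) (F : T -> V) :
  (forall x y, h (h x y) (h y x) = x) ->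
  \sum_x \sum_y F (h x y) = (\sum_x F x) *+ #|T|.
Proof.
move=> hK; rewrite (sum_swap (fun x _ => F x)) // exchange_big /=.
by rewrite sumr_const.
Qed.

Lemma sum_sqr_card (R : realDomainType) (I : finType) (a : I -> R) :
  (\sum_i a i) ^+ 2 <= #|I|%:R * \sum_i a i ^+ 2.
Proof.
have := @sum_cauchy_schwarz R I (fun=> 1) (fun=> 1) a (fun=> ler01).
under eq_bigr do rewrite !mul1r.
under [X in X * _]eq_bigr do rewrite mul1r expr1n.
under [X in _ * X]eq_bigr do rewrite mul1r.
by rewrite sumr_const.
Qed.

Section RandomAccess.
Variables (R : realType) (n : nat).
Local Open Scope sesquilinear_scope.

Definition sgb (b : bool) : R := if b then -1 else 1.

Lemma sgb_neg b : sgb (~~ b) = - sgb b.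
Proof. by case: b; rewrite /sgb /= ?opprK. Qed.

Lemma sum_ltn_ord (V : nmodType) (F : 'I_n -> V) :
  \sum_(m < n | (m < n)%N) F m = \sum_m F m.
Proof. by apply: eq_bigl => m; rewrite ltn_ord. Qed.

Definition mixp (m : nat) (x y : bits n) : bits n :=
  [ffun j : 'I_n => if (j < m)%N then x j else y j].

Lemma mixpK m x y : mixp m (mixp m x y) (mixp m y x) = x.
Proof. by apply/ffunP => j; rewrite !ffunE; case: (j < m)%N. Qed.

Lemma mixp_mix m x y z : mixp m (mixp m x y) z = mixp m x z.
Proof. by apply/ffunP => j; rewrite !ffunE; case: (j < m)%N. Qed.

Definition flip (m : 'I_n) (x : bits n) : bits n := [ffun j => x j (+) (j == m)].

Lemma flipK m : involutive (flip m).
Proof. by move=> x; apply/ffunP => j; rewrite !ffunE -addbA addbb addbF. Qed.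

Lemma sum_flip (V : nmodType) m (F : bits n -> V) :
  \sum_x F (flip m x) = \sum_x F x.
Proof. by rewrite [RHS](reindex_inj (inv_inj (flipK m))). Qed.

Lemma card_bits : #|{: bits n}| = (2 ^ n)%N.
Proof. by rewrite card_ffun card_bool card_ord. Qed.

Variables (d : nat) (f : bits n -> 'M[R[i]]_d).
Hypothesis fD : forall x, is_density (f x).
Hypothesis fH : forall x, herm (f x).

(* The martingale difference of [f] in direction [m]: bits before [m] are
   exposed as in [x], the later ones are averaged. *)
Definition incr (m : 'I_n) (x : bits n) : 'M[R[i]]_d :=
  ((2 ^+ n)^-1)%:C%C *: \sum_(y : bits n) (sgb (y m))%:C%C *: f (mixp m x y).

Lemma incr_mix m x y : incr m (mixp m x y) = incr m x.
Proof. by congr (_ *: _); apply: eq_bigr => z _; rewrite mixp_mix. Qed.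

Lemma incr_flip (m j : 'I_n) x : (m <= j)%N -> incr m (flip j x) = incr m x.
Proof.
move=> mj; congr (_ *: _); apply: eq_bigr => z _; congr (_ *: f _).
apply/ffunP => i; rewrite !ffunE; case: ltnP => // im.
by rewrite (_ : i == j = false) ?addbF //; apply/eqP => E; rewrite E ltnNge mj in im.
Qed.

Lemma herm_sum (I : finType) (P : pred I) (F : I -> 'M[R[i]]_d) :
  (forall i, herm (F i)) -> herm (\sum_(i | P i) F i).
Proof.
move=> hF; apply: (big_ind (@herm R d)) => //; last exact: hermD.
by rewrite /herm trmx0 map_mx0.
Qed.

Lemma incr_herm m x : herm (incr m x).
Proof. by apply/hermZ/herm_sum => y; apply: hermZ. Qed.

Lemma rtr_sum (I : finType) (F : I -> 'M[R[i]]_d) :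
  rtr (\sum_i F i) = \sum_i rtr (F i).
Proof.
by apply: (big_morph _ (@rtrD R d)); rewrite /rtr raddf0.
Qed.

Lemma rtr_incr m x (A : 'M[R[i]]_d) : rtr (incr m x *m A) =
  (2 ^+ n)^-1 * \sum_(y : bits n) sgb (y m) * rtr (f (mixp m x y) *m A).
Proof.
rewrite -scalemxAl rtrZ mulmx_suml rtr_sum; congr (_ * _); apply: eq_bigr => y _.
by rewrite -scalemxAl rtrZ.
Qed.

Lemma normr_sgb b : `|sgb b| = 1.
Proof. by case: b; rewrite /sgb ?normrN normr1. Qed.

Lemma trnorm_incr_le1 m x : trnorm (incr m x) <= 1.
Proof.
rewrite -(rtr_sgnmx (incr_herm m x)) rtr_incr mulrC ler_pdivrMr ?exprn_gt0 //.
rewrite mul1r; apply: le_trans (ler_norm _) _.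
apply: le_trans (ler_norm_sum _ _ _) _.
apply: (@le_trans _ _ (\sum_(y : bits n) 1)); last first.
  by rewrite sumr_const card_bits natrX.
apply: ler_sum => y _; rewrite normrM normr_sgb mul1r.
exact: rtr_density_sgnmx.
Qed.

(** Dual witness: its pairing with [incr m x] is [trnorm (incr m x) ^+ 2]. *)
Definition wsgn m x : 'M[R[i]]_d :=
  (trnorm (incr m x))%:C%C *: sgnmx (incr m x).

Lemma wsgn_herm m x : herm (wsgn m x).
Proof. exact/hermZ/sgnmx_herm. Qed.

(** A matrix martingale in the uniform bits of [x]: [wsgn m x] depends only on the bits before [m],
    and bit [m] supplies the random sign. *)
Definition wsum (j : nat) (x : bits n) : 'M[R[i]]_d :=
  \sum_(m < n | (m < j)%N) (sgb (x m))%:C%C *: wsgn m x.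

Lemma wsum_herm j x : herm (wsum j x).
Proof. by apply: herm_sum => m; apply/hermZ/wsgn_herm. Qed.

Lemma schattenN s (A : 'M[R[i]]_d) : schatten s (- A) = schatten s A.
Proof. by case: s => [|s] /=; rewrite mulmxN mulNmx opprK. Qed.

(** Flipping bit [j] reverses the last increment and fixes the earlier sum, so [schatten_smooth]
    applies to each pair formed by [x] and its flip. *)
Lemma wsum_smooth s j : (j <= n)%N ->
  \sum_x schatten s (wsum j x) ^+ 2 <=
  ((2 ^ s.+1)%:R - 1) * \sum_(m < n | (m < j)%N) \sum_x schatten s (wsgn m x) ^+ 2.
Proof.
elim: j => [|j IH] jn.
  rewrite [X in _ * X]big_pred0 // mulr0 big1 // => x _.
  rewrite /wsum big_pred0 //; case: s => [|s] /=; rewrite mulmx0.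
    by rewrite /rtr raddf0 /= sqrtr0 expr0n.
  suff -> : schatten s (0 : 'M[R[i]]_d) = 0 by rewrite sqrtr0 expr0n.
  elim: s => [|s IH] /=; rewrite mulmx0; last by rewrite IH sqrtr0.
  by rewrite /rtr raddf0 /= sqrtr0.
pose J := Ordinal jn.
have split_last (V : nmodType) (F : 'I_n -> V) :
    \sum_(m < n | (m < j.+1)%N) F m = F J + \sum_(m < n | (m < j)%N) F m.
  rewrite (bigD1 J) //=; congr (_ + _); apply: eq_bigl => m.
  by rewrite ltnS ltn_neqAle -val_eqE /= andbC.
have E (x : bits n) : wsum j.+1 x = wsum j x + (sgb (x J))%:C%C *: wsgn J x.
  by rewrite /wsum split_last addrC.
have E' (x : bits n) : wsum j.+1 (flip J x) = wsum j x - (sgb (x J))%:C%C *: wsgn J x.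
  have wj : wsum j (flip J x) = wsum j x.
    apply: eq_bigr => m mj; rewrite /wsgn incr_flip ?(ltnW mj) // ffunE.
    by rewrite -val_eqE /= (ltn_eqF mj) addbF.
  have wJ : wsgn J (flip J x) = wsgn J x by rewrite /wsgn incr_flip.
  by rewrite E wj wJ ffunE eqxx addbT sgb_neg rmorphN scaleNr.
rewrite split_last mulrDr -(@ler_pM2l _ 2) //.
have dbl (g : bits n -> R) : 2 * \sum_x g x = \sum_x (g x + g (flip J x)).
  by rewrite big_split /= (sum_flip J g) mulr_natl mulr2n.
rewrite (dbl (fun x => schatten s (wsum j.+1 x) ^+ 2)).
apply: (@le_trans _ _ (\sum_x 2 * (schatten s (wsum j x) ^+ 2 +
    ((2 ^ s.+1)%:R - 1) * schatten s (wsgn J x) ^+ 2))).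
  apply: ler_sum => x _; rewrite E E'.
  have -> : schatten s (wsgn J x) = schatten s ((sgb (x J))%:C%C *: wsgn J x).
    case: (x J); rewrite /sgb ?rmorphN rmorph1 ?scaleNr scale1r ?schattenN //.

  exact: schatten_smooth (wsum_herm j x) (hermZ _ (wsgn_herm J x)).
rewrite -mulr_sumr ler_wpM2l // big_split /= -mulr_sumr addrC lerD2l.
exact: IH (ltnW jn).
Qed.

(** The squared trace norm is the pairing of [incr m x] with [wsgn m x]. The witness sees only the
    bits before [m], so the head of [x] and the tail averaged in [incr] merge into one uniform
    string. *)
Lemma sum_incr_sqr :
  \sum_x \sum_m trnorm (incr m x) ^+ 2 = \sum_x rtr (f x *m wsum n x).
Proof.
transitivity (\sum_m \sum_(x : bits n) sgb (x m) * rtr (f x *m wsgn m x)).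
  rewrite exchange_big; apply: eq_bigr => m _.
  pose G (u : bits n) := sgb (u m) * rtr (f u *m wsgn m u).
  have mK := @mixpK m.
  have N0 : (2 ^+ n : R) != 0 by rewrite expf_neq0 // pnatr_eq0.
  apply: (mulfI N0); rewrite -/(G _).
  have := sum_swap_l G mK; rewrite card_bits -[in RHS]mulr_natl natrX => <-.
  rewrite mulr_sumr; apply: eq_bigr => x _.
  rewrite expr2 -{2}(rtr_sgnmx (incr_herm m x)) -rtrZ scalemxAr rtr_incr.
  rewrite mulrA divff // mul1r; apply: eq_bigr => y _.
  by rewrite /G /wsgn incr_mix ffunE ltnn.
rewrite exchange_big; apply: eq_bigr => x _.
rewrite /wsum sum_ltn_ord mulmx_sumr rtr_sum; apply: eq_bigr => m _.
by rewrite -[in RHS]scalemxAr rtrZ.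
Qed.

(** Self-bounding: duality, Cauchy-Schwarz and the martingale bound give
    [Q ^+ 2 <= 2 ^+ n * (K * (4 * Q))], and one [Q] cancels. *)
Lemma random_access_aux s : (d <= 2 ^ (2 ^ s.+1))%N ->
  \sum_x \sum_m trnorm (incr m x) ^+ 2 <= 4 * ((2 ^ s.+1)%:R - 1) * 2 ^+ n.
Proof.
move=> hd; set Q := \sum_x _; set K := _ - 1 : R.
have K0 : 0 <= K by rewrite subr_ge0 ler1n expn_gt0.
have Q0 : 0 <= Q by do 2 (apply: sumr_ge0 => ? _); rewrite sqr_ge0.
pose N x := schatten s (wsum n x).
have h1 : Q <= \sum_x N x.
  rewrite /Q sum_incr_sqr; apply: ler_sum => x _.
  exact: rtr_density_schatten (wsum_herm n x).
have h2 : (\sum_x N x) ^+ 2 <= 2 ^+ n * \sum_x N x ^+ 2.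
  by have := sum_sqr_card N; rewrite card_bits natrX.
have h3 : \sum_x N x ^+ 2 <= K * (4 * Q).
  apply: le_trans (wsum_smooth s (leqnn n)) _; rewrite ler_wpM2l //.
  rewrite sum_ltn_ord exchange_big mulr_sumr; apply: ler_sum => x _.
  rewrite mulr_sumr; apply: ler_sum => m _.
  rewrite (_ : 4 * _ = (2 * trnorm (incr m x)) ^+ 2); last by rewrite exprMn -natrX.
  rewrite lerXn2r ?nnegrE ?mulr_ge0 ?schatten_ge0 ?trnorm_ge0 //.
  exact: schatten_sgnmx (trnorm_ge0 _) hd.
have := Q0; rewrite le_eqVlt => /orP[/eqP <-|Qgt0].
  by rewrite !mulr_ge0 // exprn_ge0.
rewrite -(ler_pM2r Qgt0) -expr2.
apply: (le_trans (y := (\sum_x N x) ^+ 2)).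
  by rewrite lerXn2r ?nnegrE // (le_trans Q0).
apply: le_trans h2 _.
rewrite (_ : 4 * K * _ * Q = 2 ^+ n * (K * (4 * Q))); last by ring.
by rewrite ler_wpM2l // exprn_ge0.
Qed.

End RandomAccess.

Theorem random_access (R : realType) n c (f : bits n -> 'M[R[i]]_(2 ^ c)) :
  (forall x, is_density (f x)) -> (forall x, herm (f x)) ->
  (forall x, \tr (f x) = 1) ->
  \sum_x \sum_m trnorm (incr f m x) ^+ 2 <= 8 * c%:R * 2 ^+ n.
Proof.
move=> fD fH fT.
have [c0|c0] := posnP c.
  (* Without qubits the bound is 0: the message is the 1 by 1 matrix with entry 1, and the signs in
     [incr] cancel under a flip of bit [m]. *)
  subst c; rewrite mulr0 mul0r big1 // => x _; rewrite big1 // => m _.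
  suff -> : incr f m x = 0.
    rewrite -rtr_sgnmx ?mul0mx; last by rewrite /herm trmx0 map_mx0.
    by rewrite /rtr raddf0 expr0n.
  apply/matrixP => i j; rewrite /incr mxE summxE mxE.
  rewrite (ord1 i) (ord1 j).
  have e1 y : f y ord0 ord0 = 1 by rewrite -(fT y) /mxtrace big_ord1.
  under eq_bigr do rewrite mxE e1 mulr1.
  set S := \sum_y _; suff : S = - S by move/eqP; rewrite -addr_eq0 -mulr2n
    mulrn_eq0 /= => /eqP ->; rewrite mulr0.
  rewrite /S -{1}(sum_flip m) -sumrN; apply: eq_bigr => y _.
  by rewrite ffunE eqxx addbT sgb_neg rmorphN.
(* The first bound makes the dimension small enough for the exponent; the second turns the factor 4
   into 8. *)
have [s [h1 h2]] : exists s, (c <= 2 ^ s.+1)%N /\ (2 ^ s.+1 <= 2 * c)%N.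
  have [c1|c1] := leqP c 1; first by exists 0%N; lia.
  have := @up_logP 2 c isT; have := @up_log_gtn 2 c isT c1.
  case: (up_log 2 c) => [|s] /=; first by lia.
  by move=> h1 h2; exists s; split=> //; rewrite expnS leq_mul2l /= ltnW.
have h3 : (2 ^ c <= 2 ^ (2 ^ s.+1))%N by rewrite leq_exp2l.
apply: le_trans (random_access_aux fD fH h3) _.
rewrite ler_wpM2r ?exprn_ge0 //.
by have := h2; rewrite -(ler_nat R) (natrM _ 2 c); lra.
Qed.

(** * Hybrid argument *)

(** Distributivity when the index type varies with [i]: dependent functions become functions into
    the tagged union, where the law for a single codomain applies. *)
Lemma prod_sum_dffun (K : comPzSemiRingType) (I : finType) (T : I -> finType)
    (F : forall i, T i -> K) :
  \prod_i \sum_(j : T i) F i j =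
  \sum_(f : {dffun forall i, T i}) \prod_i F i (f i).
Proof.
rewrite (reindex (@dffun_of_fprod I T)) /=; last exact/onW_bij/dffun_of_fprod_bij.
transitivity (\sum_(t : fprod T) \prod_(i in I) [ffun j => F i j] (t i)).
  rewrite (@big_fprod K 0 1 *%R _ I T (fun i => [ffun j => F i j])).
  transitivity (\sum_(g in family (tagged_with T))
     \prod_i untag 0 [ffun j => F i j] (g i)); last by [].
  rewrite -(bigA_distr_big_dep _ (fun i g => untag 0 [ffun j => F i j] g)).
  apply: eq_bigr => i _; rewrite -(big_tag (fun i j => [ffun j => F i j] j)).
  by apply: eq_bigr => j _; rewrite ffunE.
by apply: eq_bigr => t _; apply: eq_bigr => i _; rewrite !ffunE.
Qed.

(** * Measurements against tensor products *)

Section Tensor.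
Variables (R : realType) (k : nat) (q : 'I_k -> nat).
Local Open Scope sesquilinear_scope.
Implicit Types (M : cmat R (joint q)) (D : forall i, 'M[R[i]]_(2 ^ q i)).

Definition tracetens M D : R[i] :=
  \sum_a \sum_c M a c * \prod_i D i (c i) (a i).

(** Products of eigenvectors of the [D i] are unit vectors [u m] with eigenvalue [lam m]. The
    measurement has a value in [0, 1] on each, so the trace is bounded by the sum of the absolute
    values of [lam m], which factors over [i]. *)
Lemma norm_tracetens M D : psd M -> psd (fun a c => idmat R a c - M a c) ->
  (forall i, herm (D i)) ->
  `|tracetens M D| <= (\prod_i trnorm (D i))%:C%C.
Proof.
move=> M0 M1 hD.
pose u (m : joint q) : joint q -> R[i] :=
  fun a => (\prod_i spectralmx (D i) (m i) (a i))^*.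
pose lam (m : joint q) : R := \prod_i eigvals (D i) 0 (m i).
have DE (a c : joint q) : \prod_i D i (c i) (a i) = \sum_m (lam m)%:C%C * ((u m a)^* * u m c).
  under eq_bigr do rewrite (herm_entry (hD _)).
  rewrite prod_sum_dffun; apply: eq_bigr => m _.
  rewrite !big_split /= /u conjCK rmorph_prod /lam rmorph_prod /=.
  by congr (_ * _); rewrite mulrC.
pose F (m : joint q) := \sum_a \sum_c (u m a)^* * M a c * u m c.
have -> : tracetens M D = \sum_m (lam m)%:C%C * F m.
  rewrite /tracetens; under eq_bigr do under eq_bigr do rewrite DE mulr_sumr.
  under eq_bigr do rewrite exchange_big.
  rewrite exchange_big; apply: eq_bigr => m _; rewrite mulr_sumr.
  apply: eq_bigr => a _; rewrite mulr_sumr; apply: eq_bigr => c _; ring.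
have F0 m : 0 <= F m by apply: M0.
have F1 m : F m <= 1.
  have := M1 (u m).
  suff -> : \sum_a \sum_c (u m a)^* * (idmat R a c - M a c) * u m c = 1 - F m.
    by rewrite subr_ge0.
  under eq_bigr do under eq_bigr do rewrite mulrBr mulrBl.
  under eq_bigr do rewrite sumrB.
  rewrite sumrB; congr (_ - _).
  transitivity (\sum_(a : joint q) \prod_i (spectralmx (D i) (m i) (a i) *
                               (spectralmx (D i) (m i) (a i))^*)).
    apply: eq_bigr => a _; rewrite (bigD1 a) //= big1 ?addr0.
      by rewrite /idmat eqxx mulr1 /u conjCK rmorph_prod big_split.
    by move=> c /negbTE ca; rewrite /idmat eq_sym ca mulr0 mul0r.
  rewrite -(prod_sum_dffun (fun i (a : 'I_(2 ^ q i)) => spectralmx (D i) (m i) a *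
                               (spectralmx (D i) (m i) a)^*)).
  rewrite big1 // => i _.
  have := congr1 (fun A : 'M__ => A (m i) (m i)) (spectral_mul (D i)).
  rewrite !mxE eqxx => E; apply: etrans E.
  by apply: eq_bigr => j _; rewrite !mxE.
apply: le_trans (ler_norm_sum _ _ _) _.
rewrite /trnorm prod_sum_dffun rmorph_sum; apply: ler_sum => m _.
rewrite normrM (ger0_norm (F0 m)).
have -> : `|(lam m)%:C%C| = (\prod_i `|eigvals (D i) 0 (m i)|)%:C%C.
  by rewrite normc_def /= expr0n addr0 sqrtr_sqr /lam normr_prod.
by rewrite ler_piMr ?F1 // ler0c prodr_ge0.
Qed.

End Tensor.

Section Hybrid.
Variables (R : realType) (k n : nat).
Notation inputs := {ffun 'I_k -> bits n}.
Variables (J : pred 'I_n) (b : bool).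

Definition chi (j : 'I_n) (X : inputs) : R := \prod_i sgb R (X i j).

(* Up to normalization, the density of the uniform distribution on inputs whose
   XOR equals [b] at the positions of [J] below [m]. *)
Definition weight (m : nat) (X : inputs) : R :=
  \prod_(j < n | J j && (j < m)%N) (1 + sgb R b * chi j X).

Lemma sgb_pm c : sgb R c = 1 \/ sgb R c = -1.
Proof. by case: c; rewrite /sgb; auto. Qed.

Lemma chi_pm j X : chi j X = 1 \/ chi j X = -1.
Proof.
apply: (big_ind (fun x : R => x = 1 \/ x = -1)) => [|x y|i _]; first by left.
  by case=> ->; case=> ->; rewrite ?mul1r ?mulrN1 ?mulr1 ?opprK; auto.
exact: sgb_pm.
Qed.

Lemma weight_ge0 m X : 0 <= weight m X.
Proof.
apply: prodr_ge0 => j _; case: (sgb_pm b) => ->; case: (chi_pm j X) => ->; lra.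
Qed.

Lemma chiE j X : chi j X = sgb R (\big[addb/false]_i X i j).
Proof.
rewrite /chi; apply/esym/(big_morph (sgb R)) => //.
by case; case; rewrite /sgb /= ?mulrN1 ?mul1r ?mulr1 ?opprK.
Qed.

Lemma weight_supp X : weight n X != 0 -> forall j, J j -> xorall X j = b.
Proof.
move=> w0 j Jj; rewrite ffunE; move: w0; rewrite /weight (bigD1 j) ?Jj ?ltn_ord //=.
rewrite mulf_eq0 negb_or chiE => /andP[+ _]; rewrite /sgb.
by case: b; case: (\big[_/_]_i _) => //=; rewrite ?mulrN ?mulNr ?mulr1 ?subrr ?eqxx.
Qed.

Lemma weight0 X : weight 0 X = 1.
Proof. by rewrite /weight big_pred0 // => j; rewrite andbF. Qed.

Lemma weightS (m : 'I_n) X : weight m.+1 X =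
  weight m X + (if J m then sgb R b * chi m X * weight m X else 0).
Proof.
rewrite /weight; case: ifP => Jm.
  rewrite (bigD1 m) ?Jm ?leqnn //= mulrDl mul1r; congr (_ + _ * _);
  apply: eq_bigl => j; rewrite ltnS ltn_neqAle -val_eqE; case: (J j) => //=;
  by rewrite andbC.
rewrite addr0; apply: eq_bigl => j; rewrite ltnS [(j <= m)%N]leq_eqVlt.
by case: eqP => // /val_inj ->; rewrite Jm.
Qed.

Definition upd (i0 : 'I_k) (X : inputs) (u : bits n) : inputs :=
  [ffun i => if i == i0 then u else X i].

Lemma sum_upd (V : nmodType) i0 (G : inputs -> V) :
  \sum_X \sum_u G (upd i0 X u) = (\sum_X G X) *+ 2 ^ n.
Proof.
transitivity (\sum_X \sum_(u : bits n) G X); last first.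
  by rewrite exchange_big sumr_const card_bits.
rewrite !pair_bigA /=.
pose h (p : inputs * bits n) := (upd i0 p.1 p.2, p.1 i0).
have hK : involutive h.
  move=> [X u]; rewrite /h /= ffunE eqxx; congr pair; apply/ffunP => i.
  by rewrite !ffunE; case: eqP => // ->.
by rewrite [RHS](reindex_inj (inv_inj hK)).
Qed.

(** At a constrained position the two values of the bit of player [i0] give factors [1 + cc j] and
    [1 - cc j], with sum 2: the XOR constraint is invisible to the other players. *)
Lemma sum_weight_upd m i0 X : \sum_u weight m (upd i0 X u) = 2 ^+ n.
Proof.
pose cc j := sgb R b * \prod_(i | i != i0) sgb R (X i j).
transitivity (\sum_(u : bits n) \prod_j
   (if J j && (j < m)%N then 1 + cc j * sgb R (u j) else 1)).
  apply: eq_bigr => u _; rewrite /weight big_mkcond; apply: eq_bigr => j _.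
  case: ifP => // _; rewrite /chi (bigD1 i0) //= ffunE eqxx /cc -mulrA.
  congr (_ + _ * _); rewrite mulrC; congr (_ * _); apply: eq_bigr => i ne.
  by rewrite ffunE (negbTE ne).
rewrite -(bigA_distr_bigA (fun j c => if J j && (j < m)%N then 1 + cc j * sgb R c else 1)).
rewrite (eq_bigr (fun=> 2)) ?prodr_const ?card_ord // => j _.
rewrite big_bool /sgb; case: (J j && _) => /=; ring.
Qed.

Lemma sum_weight_marginal m i0 (F : inputs -> R) :
  (forall X u, F (upd i0 X u) = F X) ->
  \sum_X weight m X * F X = \sum_X F X.
Proof.
move=> hF; have N0 : (2 ^+ n : R) != 0 by rewrite expf_neq0 // pnatr_eq0.
apply: (mulfI N0).
have E := sum_upd i0 (fun X => weight m X * F X).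
rewrite -[_ *+ _]mulr_natl natrX in E; rewrite -E mulr_sumr; apply: eq_bigr => X _.
under eq_bigr do rewrite hF.
by rewrite -mulr_suml sum_weight_upd.
Qed.

Lemma sum_prod (K : comPzSemiRingType) (h : 'I_k -> bits n -> K) :
  \sum_(X : inputs) \prod_i h i (X i) = \prod_i \sum_x h i x.
Proof. by rewrite bigA_distr_bigA. Qed.

(* Any [k - 1] players are independent under [weight m], so one Cauchy-Schwarz
   step separating a single player from the others suffices. *)
Lemma sum_weight_prod m (g : 'I_k -> bits n -> R) : (2 <= k)%N ->
  (forall i x, 0 <= g i x) ->
  \sum_X weight m X * \prod_i g i (X i) <=
  (2 ^+ n) ^+ k * \prod_i Num.sqrt ((2 ^+ n)^-1 * \sum_x g i x ^+ 2).
Proof.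
move=> k2 g0.
have k0 : (0 < k)%N by apply: leq_trans k2.
pose i0 := Ordinal k0; pose i1 := Ordinal k2.
have i01 : i0 != i1 by [].
pose A (X : inputs) := \prod_(i | i != i1) g i (X i).
pose B (X : inputs) := g i1 (X i1).
have N0 : 0 < (2 ^+ n : R) by rewrite exprn_gt0.
rewrite -(@ler_pXn2r _ 2) ?nnegrE //; last 2 first.
- apply: sumr_ge0 => X _; rewrite mulr_ge0 ?weight_ge0 //.
  by apply: prodr_ge0 => i _.
- rewrite mulr_ge0 ?exprn_ge0 ?(ltW N0) //; apply: prodr_ge0 => i _.
  exact: sqrtr_ge0.
have -> : \sum_X weight m X * \prod_i g i (X i) = \sum_X weight m X * (A X * B X).
  by apply: eq_bigr => X _; rewrite (bigD1 i1) //= [g _ _ * _]mulrC.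
apply: le_trans (sum_cauchy_schwarz _ _ (weight_ge0 m)) _.
(* [A] ignores player [i1] and [B] ignores player [i0], so the weight disappears from both
   factors. *)
rewrite (@sum_weight_marginal m i1 (fun X => A X ^+ 2)); last first.
  move=> X u; congr (_ ^+ 2); apply: eq_bigr => i ne.
  by rewrite ffunE (negbTE ne).
rewrite (@sum_weight_marginal m i0 (fun X => B X ^+ 2)); last first.
  by move=> X u; rewrite /B ffunE eq_sym (negbTE i01).
have cst1 : \sum_(x : bits n) 1 = 2 ^+ n :> R by rewrite sumr_const card_bits natrX.
have -> : \sum_X A X ^+ 2 = 2 ^+ n * \prod_(i | i != i1) \sum_x g i x ^+ 2.
  transitivity (\sum_(X : inputs) \prod_i (if i == i1 then 1 else g i (X i) ^+ 2)).
    apply: eq_bigr => X _; rewrite /A -prodrXl [RHS](bigD1 i1) //= ?eqxx mul1r.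
    by apply: eq_bigr => i /negbTE ->.
  rewrite (sum_prod (fun i x => if i == i1 then 1 else g i x ^+ 2)) (bigD1 i1) //=.
  rewrite ?eqxx cst1; congr (_ * _); apply: eq_bigr => i /negbTE ne.
  by apply: eq_bigr => x _; rewrite ne.
have -> : \sum_X B X ^+ 2 = (2 ^+ n) ^+ k.-1 * \sum_x g i1 x ^+ 2.
  transitivity (\sum_(X : inputs) \prod_i (if i == i1 then g i (X i) ^+ 2 else 1)).
    apply: eq_bigr => X _; rewrite [RHS](bigD1 i1) //= big1 ?mulr1 //.
    by move=> i /negbTE ->.
  rewrite (sum_prod (fun i x => if i == i1 then g i x ^+ 2 else 1)) (bigD1 i1) //=.
  rewrite mulrC; congr (_ * _).
  rewrite (eq_bigr (fun=> 2 ^+ n)); last first.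
    by move=> i /negbTE ne; rewrite -cst1; apply: eq_bigr => x _; rewrite ne.
  by rewrite prodr_const cardC1 card_ord.
rewrite exprMn -prodrXl.
rewrite [X in _ <= _ * X](eq_bigr (fun i => (2 ^+ n)^-1 * \sum_x g i x ^+ 2)); last first.
  move=> i _; rewrite sqr_sqrtr // mulr_ge0 ?invr_ge0 ?(ltW N0) //.
  by apply: sumr_ge0 => x _; rewrite sqr_ge0.
rewrite big_split /= prodr_const card_ord.
rewrite [X in _ <= _ * (_ * X)](bigD1 i1) //= exprVn.
have ak : (2 ^+ n : R) ^+ k = 2 ^+ n * (2 ^+ n) ^+ k.-1 by rewrite -exprS prednK.
have ak0 : (2 ^+ n : R) ^+ k != 0 by rewrite expf_neq0 // gt_eqF.
rewrite [in leRHS]expr2 -[leRHS]mulrA mulVKf // ak.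
rewrite le_eqVlt; apply/orP; left; apply/eqP.
move: (\prod_(i | _) _) (\sum_x _) ((2 ^+ n : R) ^+ k.-1) (2 ^+ n : R) => p t u v.
ring.
Qed.

End Hybrid.

Lemma incr_entry (R : realType) n d (f : bits n -> 'M[R[i]]_d) m x u v :
  incr f m x u v = ((2 ^+ n)^-1)%:C%C *
    \sum_(y : bits n) (sgb R (y m))%:C%C * f (mixp m x y) u v.
Proof.
rewrite /incr mxE; congr (_ * _); rewrite summxE; apply: eq_bigr => y _.
by rewrite mxE.
Qed.

Section HybridStep.
Variables (R : realType) (k n : nat).
Notation inputs := {ffun 'I_k -> bits n}.
Variables (J : pred 'I_n) (b : bool) (q : 'I_k -> nat) (M : cmat R (joint q)).
Variable f : forall i, bits n -> 'M[R[i]]_(2 ^ q i).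

Definition step_bound (m : 'I_n) : R :=
  \prod_i Num.sqrt ((2 ^+ n)^-1 * \sum_x trnorm (incr (f i) m x) ^+ 2).

Hypothesis k2 : (2 <= k)%N.
Hypothesis M0 : psd M.
Hypothesis M1 : psd (fun a c => idmat R a c - M a c).
Hypothesis fH : forall i x, herm (f i x).

Let acc (X : inputs) := tracetens M (fun i => f i (X i)).

Definition mixk (m : nat) (X Y : inputs) : inputs :=
  [ffun i => mixp m (X i) (Y i)].

(** As [chi] is a product over the players, the sum over the tails factors into one signed average,
    that is one increment, per player. *)
Lemma sum_sgb_tracetens (m : 'I_n) (X : inputs) :
  \sum_Y (chi R m Y)%:C%C * tracetens M (fun i => f i (mixk m X Y i)) =
  ((2 ^+ n) ^+ k)%:C%C * tracetens M (fun i => incr (f i) m (X i)).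
Proof.
rewrite /tracetens mulr_sumr.
under eq_bigr do rewrite mulr_sumr.
rewrite exchange_big; apply: eq_bigr => a _; rewrite mulr_sumr.
under eq_bigr do rewrite mulr_sumr.
rewrite exchange_big; apply: eq_bigr => c _.
transitivity (M a c * \sum_(Y : inputs) \prod_i ((sgb R (Y i m))%:C%C *
    f i (mixp m (X i) (Y i)) (c i) (a i))).
  rewrite mulr_sumr; apply: eq_bigr => Y _; rewrite mulrCA; congr (_ * _).
  rewrite big_split /= rmorph_prod; congr (_ * _).
  by apply: eq_bigr => i _; rewrite ffunE.
rewrite mulrCA; congr (_ * _).
rewrite (sum_prod (fun i y => (sgb R (y m))%:C%C *
    f i (mixp m (X i) y) (c i) (a i))).
have -> : ((2 ^+ n) ^+ k)%:C%C = \prod_(i < k) (2 ^+ n : R)%:C%C :> R[i].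
  by rewrite prodr_const card_ord rmorphXn.
rewrite -big_split; apply: eq_bigr => i _.
rewrite incr_entry /= mulrA -rmorphM divff ?expf_neq0 ?pnatr_eq0 //.
by rewrite rmorph1 mul1r.
Qed.

(** [weight m] sees only the positions before [m], so averaging over the tails replaces messages by
    increments. Then [norm_tracetens] bounds each trace and [sum_weight_prod] their weighted sum. *)
Lemma hybrid_step (m : 'I_n) :
  `|\sum_X (sgb R b * chi R m X * weight R J b m X)%:C%C * acc X| <=
  ((2 ^+ n) ^+ k * step_bound m)%:C%C.
Proof.
have N0 : ((2 ^+ n) ^+ k)%:C%C != 0 :> R[i].
  by rewrite eq_complex /= eqxx andbT expf_neq0 // expf_neq0 // pnatr_eq0.
pose G X := (sgb R b * chi R m X * weight R J b m X)%:C%C * acc X.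
have mK X Y : mixk m (mixk m X Y) (mixk m Y X) = X.
  by apply/ffunP => i; rewrite !ffunE mixpK.
have E : \sum_X G X = \sum_X (sgb R b * weight R J b m X)%:C%C *
    tracetens M (fun i => incr (f i) m (X i)).
  apply: (mulfI N0); have := sum_swap_l G mK.
  rewrite -[_ *+ _]mulr_natl (_ : _%:R = ((2 ^+ n) ^+ k)%:C%C); last first.
    by rewrite card_ffun card_ord card_bits !natrX !rmorphXn rmorph_nat.
  move=> <-; rewrite mulr_sumr; apply: eq_bigr => X _; rewrite mulrCA.
  rewrite -sum_sgb_tracetens mulr_sumr; apply: eq_bigr => Y _.
  rewrite /G mulrA -rmorphM; congr (_%:C%C * _).
  have -> : chi R m (mixk m X Y) = chi R m Y.
    by apply: eq_bigr => i _; rewrite !ffunE ltnn.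
  rewrite mulrAC; congr (_ * _ * _); apply: eq_bigr => j /andP[_ jm].
  by congr (1 + _ * _); apply: eq_bigr => i _; rewrite !ffunE jm.
rewrite E; apply: le_trans (ler_norm_sum _ _ _) _.
apply: (@le_trans _ _ (\sum_X weight R J b m X *
    \prod_i trnorm (incr (f i) m (X i)))%:C%C); last first.
  rewrite lecR; apply: (@sum_weight_prod R k n J b m
    (fun i x => trnorm (incr (f i) m x))) => // i x; exact: trnorm_ge0.
rewrite rmorph_sum; apply: ler_sum => X _; rewrite normrM [in leRHS]rmorphM.
have -> : `|(sgb R b * weight R J b m X)%:C%C| = (weight R J b m X)%:C%C :> R[i].
  rewrite normc_def /= expr0n addr0 sqrtr_sqr normrM normr_sgb mul1r.
  by rewrite ger0_norm // weight_ge0.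
rewrite ler_wpM2l ?ler0c ?weight_ge0 //.
by apply: norm_tracetens => // i; apply: incr_herm.
Qed.

(** Telescoping over the positions; by [weightS] only those in [J] contribute. *)
Lemma hybrid_sum :
  `|\sum_X (weight R J b n X)%:C%C * acc X - \sum_X acc X| <=
  ((2 ^+ n) ^+ k * \sum_(m | J m) step_bound m)%:C%C.
Proof.
have aux j : (j <= n)%N ->
    `|\sum_X (weight R J b j X)%:C%C * acc X - \sum_X acc X| <=
    ((2 ^+ n) ^+ k * \sum_(m < n | (m < j)%N) (if J m then step_bound m else 0))%:C%C.
  elim: j => [|j IH] jn.
    rewrite [\sum_(_ < _ | _) _]big_pred0 // mulr0 -sumrB big1 ?normr0 // => X _.
    by rewrite weight0 mul1r subrr.
  pose m := Ordinal jn.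
  have -> : \sum_(m < n | (m < j.+1)%N) (if J m then step_bound m else 0) =
     \sum_(m < n | (m < j)%N) (if J m then step_bound m else 0) +
     (if J m then step_bound m else 0).
    rewrite (bigD1 m) //= addrC; congr (_ + _); apply: eq_bigl => i.
    by rewrite ltnS ltn_neqAle -val_eqE /= andbC.
  rewrite mulrDr rmorphD.
  have -> : \sum_X (weight R J b j.+1 X)%:C%C * acc X - \sum_X acc X =
    (\sum_X (weight R J b j X)%:C%C * acc X - \sum_X acc X) +
    (if J m then \sum_X (sgb R b * chi R m X * weight R J b m X)%:C%C * acc X else 0).
    rewrite addrAC; congr (_ - _).
    case Jm : (J m).
      rewrite -big_split; apply: eq_bigr => X _ /=.
      by rewrite (weightS R J b m X) Jm rmorphD mulrDl.
    rewrite addr0; apply: eq_bigr => X _.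
    by rewrite (weightS R J b m X) Jm addr0.
  apply: le_trans (ler_normD _ _) _; apply: lerD; first exact: IH (ltnW jn).
  by case: (J m); [exact: hybrid_step | rewrite mulr0 normr0].
have := aux n (leqnn n); rewrite sum_ltn_ord -big_mkcond //.
Qed.

End HybridStep.

(** * Acceptance probabilities of a protocol *)

Section Solving.
Variables (R : realType) (k n : nat) (P : qprot R k n).
Notation inputs := {ffun 'I_k -> bits n}.

Definition qmx (r : {ffun {set 'I_k} -> q_Omega P}) (i : 'I_k) (x : bits n) :
    'M[R[i]]_(2 ^ q_len P i) := \matrix_(a, c) q_st P i x r a c.

Lemma qprobE (X : 'I_k -> bits n) c : qprob P X c =
  \sum_r (prob_rand (q_pr P) r)%:C%C * tracetens (q_M P c) (fun i => qmx r i (X i)).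
Proof.
apply: eq_bigr => r _; congr (_ * _); apply: eq_bigr => a _.
apply: eq_bigr => d _; congr (_ * _); apply: eq_bigr => i _; by rewrite mxE.
Qed.

Variable allowed : pred {set 'I_k}.
Hypothesis Pv : qvalid allowed P.

Lemma prob_rand_ge0 r : 0 <= prob_rand (q_pr P) r.
Proof. by case: Pv => -[p0 _] _; apply: prodr_ge0. Qed.

Lemma sum_prob_rand : \sum_r prob_rand (q_pr P) r = 1.
Proof.
case: Pv => -[_ p1] _; rewrite /prob_rand.
rewrite -(bigA_distr_bigA (fun S w => q_pr P S w)) big1 //.
Qed.

Lemma qmx_density r i x : is_density (qmx r i x).
Proof.
case: Pv => _ [/(_ i x r) [h1 h2] _]; apply: psd_density.
  move=> v; have := h1 v; congr (_ <= _); apply: eq_bigr => a _.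
  by apply: eq_bigr => c _; rewrite mxE.
by rewrite -[RHS]h2; apply: eq_bigr => a _; rewrite mxE.
Qed.

Lemma qmx_tr r i x : \tr (qmx r i x) = 1.
Proof.
case: Pv => _ [/(_ i x r) [h1 h2] _].
by rewrite -[RHS]h2; apply: eq_bigr => a _; rewrite mxE.
Qed.

Lemma qmx_herm r i x : herm (qmx r i x).
Proof.
case: Pv => _ [/(_ i x r) [h1 _] _]; apply/matrixP => a c.
by rewrite !mxE [RHS](psd_herm h1).
Qed.

Lemma qprob_sum X : qprob P X false + qprob P X true = 1.
Proof.
rewrite !qprobE -big_split /= -(rmorph1 (real_complex R)) -sum_prob_rand rmorph_sum.
apply: eq_bigr => r _; rewrite -mulrDr -[RHS]mulr1; congr (_ * _).
case: Pv => _ [_ [_ [_ hM]]].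
transitivity (\sum_(a : joint (q_len P)) \prod_i qmx r i (X i) (a i) (a i)).
  rewrite /tracetens -big_split; apply: eq_bigr => a _ /=.
  rewrite -big_split (bigD1 a) //= -mulrDl hM /idmat eqxx mul1r [X in _ + X]big1 ?addr0 //.
  by move=> c /negbTE ca; rewrite -mulrDl hM /idmat eq_sym ca mul0r.
rewrite -(prod_sum_dffun (fun i (a : 'I_(2 ^ q_len P i)) => qmx r i (X i) a a)).
by rewrite big1 // => i _; apply: qmx_tr.
Qed.

Definition mean_bound (m : 'I_n) : R :=
  \sum_r prob_rand (q_pr P) r * step_bound (qmx r) m.

Lemma qprob_hybrid J b : (2 <= k)%N ->
  `|\sum_(X : inputs) (weight R J b n X)%:C%C * qprob P X true -
    \sum_(X : inputs) qprob P X true| <=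
  ((2 ^+ n) ^+ k * \sum_(m | J m) mean_bound m)%:C%C.
Proof.
move=> k2; case: (Pv) => _ [_ [_ [hM hI]]].
have M1 : psd (fun a c => idmat R a c - q_M P true a c).
  move=> v; have := hM false v; congr (_ <= _); apply: eq_bigr => a _.
  by apply: eq_bigr => c _; rewrite -hI addrK.
have -> : \sum_(X : inputs) (weight R J b n X)%:C%C * qprob P X true -
    \sum_(X : inputs) qprob P X true = \sum_r (prob_rand (q_pr P) r)%:C%C *
  (\sum_(X : inputs) (weight R J b n X)%:C%C *
      tracetens (q_M P true) (fun i => qmx r i (X i)) -
   \sum_(X : inputs) tracetens (q_M P true) (fun i => qmx r i (X i))).
  under eq_bigr do rewrite qprobE mulr_sumr.
  under [X in _ - X]eq_bigr do rewrite qprobE.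
  rewrite exchange_big [X in _ - X]exchange_big -sumrB; apply: eq_bigr => r _.
  rewrite mulrBr !mulr_sumr; congr (_ - _); apply: eq_bigr => X _.
  by rewrite mulrCA.
apply: le_trans (ler_norm_sum _ _ _) _.
rewrite /mean_bound exchange_big mulr_sumr rmorph_sum; apply: ler_sum => r _.
rewrite -mulr_sumr mulrCA normrM rmorphM.
have -> : `|(prob_rand (q_pr P) r)%:C%C| = (prob_rand (q_pr P) r)%:C%C :> R[i].
  by rewrite ger0_norm // ler0c prob_rand_ge0.
rewrite ler_wpM2l ?ler0c ?prob_rand_ge0 //.
by apply: hybrid_sum => // i x; apply: qmx_herm.
Qed.

(** Forcing the XOR to [b] on more than two thirds of the positions ensures the promise and the
    answer [b], so the mean acceptance probabilities for the two values differ by at least 1/3. Each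
    is compared with uniform inputs, whence half of 1/3. *)
Lemma solving_bound J : (2 <= k)%N -> qsolves P -> (2 * n < 3 * #|J|)%N ->
  1 / 6 <= \sum_(m | J m) mean_bound m.
Proof.
move=> k2 Ps hJ.
have hw_ge (z : bits n) : (forall j, J j -> z j) -> (#|J| <= hw z)%N.
  by move=> h; apply/subset_leq_card/subsetP => j jJ; rewrite inE h.
have hw_le (z : bits n) : (forall j, J j -> z j = false) -> (hw z + #|J| <= n)%N.
  move=> h; rewrite -[leqRHS]card_ord -(cardC J) addnC leq_add2l.
  apply/subset_leq_card/subsetP => j; rewrite !inE; apply: contraL => jJ.
  by rewrite h.
have GPE b (X : inputs) : (forall j, J j -> xorall X j = b) ->
    GP_promise X /\ GP X = b.
  rewrite /GP_promise /GP; case: b => h.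
    by have := hw_ge _ h; split; [lia | apply/idP; lia].
  have := hw_le _ h; have := max_card J; rewrite card_ord => Jn.
  by move=> h'; split; [lia | apply/negbTE; rewrite -ltnNge; lia].
pose N : R := (2 ^+ n) ^+ k.
have N0 : 0 < N by rewrite !exprn_gt0.
have sumw b : \sum_(X : inputs) weight R J b n X = N.
  have := @sum_weight_marginal R k n J b n (Ordinal (ltnW k2)) (fun=> 1) (fun _ _ => erefl).
  under eq_bigr do rewrite mulr1.
  by rewrite sumr_const card_ffun card_ord card_bits !natrX.
pose T b := \sum_(X : inputs) (weight R J b n X)%:C%C * qprob P X true.
have T1 : (2 / 3 * N)%:C%C <= T true.
  rewrite -(sumw true) mulr_sumr rmorph_sum; apply: ler_sum => X _.
  have [w0|w0] := eqVneq (weight R J true n X) 0; first by rewrite w0 mulr0 mul0r.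
  rewrite mulrC rmorphM ler_wpM2l ?ler0c ?weight_ge0 //.
  have [h1 h2] := GPE _ _ (weight_supp w0).
  by have := Ps _ h1; rewrite h2.
have T0 : T false <= (1 / 3 * N)%:C%C.
  rewrite -(sumw false) mulr_sumr rmorph_sum; apply: ler_sum => X _.
  have [w0|w0] := eqVneq (weight R J false n X) 0; first by rewrite w0 mulr0 mul0r.
  rewrite [in leRHS]mulrC rmorphM ler_wpM2l ?ler0c ?weight_ge0 //.
  have [h1 h2] := GPE _ _ (weight_supp w0).
  have := Ps _ h1; rewrite h2.
  have -> : qprob P X true = 1 - qprob P X false by rewrite -(qprob_sum X) addrC addKr.
  rewrite lerBlDr -lerBlDl => /(le_trans _); apply.
  by rewrite -(rmorph1 (real_complex R)) -rmorphB lecR; lra.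
have := qprob_hybrid J true k2; have := qprob_hybrid J false k2.
rewrite -/(T true) -/(T false) -/N; set U := \sum_X _; set S := \sum_(m | _) _.
move=> h0 h1.
have : (1 / 3 * N)%:C%C <= (2 * (N * S))%:C%C :> R[i].
  have D1 : (1 / 3 * N)%:C%C <= T true - T false.
    have -> : 1 / 3 * N = 2 / 3 * N - 1 / 3 * N by lra.
    by rewrite rmorphB lerB.
  apply: (le_trans D1); rewrite -(ger0_norm (le_trans _ D1)); last first.
    by rewrite ler0c mulr_ge0 ?(ltW N0) // divr_ge0.
  have -> : T true - T false = (T true - U) - (T false - U) by ring.
  apply: le_trans (ler_normB _ _) _.
  by rewrite [2 * _]mulr_natl mulr2n rmorphD lerD.
rewrite lecR; have -> : 2 * (N * S) = 2 * S * N by ring.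
by rewrite ler_pM2r //; lra.
Qed.

End Solving.

(** * Shared randomness *)

Lemma powR_prod (R : realType) (I : finType) (A : pred I) (a : I -> R) p :
  (forall i, 0 <= a i) -> (\prod_(i | A i) a i) `^ p = \prod_(i | A i) a i `^ p.
Proof.
move=> a0; apply: (proj2 (A := 0 <= \prod_(i | A i) a i)).
apply: (big_ind2 (fun x y => 0 <= x /\ x `^ p = y)) => //.
- by rewrite powR1.
- by move=> x y x' y' [x0 <-] [x0' <-]; rewrite mulr_ge0 ?powRM.
Qed.

Lemma powR_invK (R : realType) t (a : R) : (0 < t)%N -> 0 <= a ->
  (a `^ (t%:R^-1)) ^+ t = a.
Proof.
move=> t0 a0; rewrite -powR_mulrn ?powR_ge0 // -powRrM mulVf ?powRr1 //.
by rewrite pnatr_eq0 -lt0n.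
Qed.

Lemma exprnK_powR (R : realType) t (a : R) : (0 < t)%N -> 0 <= a ->
  (a ^+ t) `^ (t%:R^-1) = a.
Proof.
move=> t0 a0; rewrite -powR_mulrn // -powRrM divff ?powRr1 //.
by rewrite pnatr_eq0 -lt0n.
Qed.

(** The arithmetic-geometric mean inequality for exactly [t] numbers: the [u i], padded with
    ones. *)
Lemma padded_AGM (R : realType) (I : finType) (A : {pred I}) (u : I -> R) t :
  (0 < t)%N -> (#|A| <= t)%N -> (forall i, 0 <= u i) ->
  \prod_(i in A) u i `^ (t%:R^-1) <= (\sum_(i in A) u i + (t - #|A|)%:R) / t%:R.
Proof.
move=> t0 At u0; move: (subnKC At); move: (t - #|A|)%N => e he.
pose B : {pred I + 'I_e} := fun x => if x is inl i then i \in A else true.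
pose E (x : I + 'I_e) : R := if x is inl i then u i else 1.
have E0 x : 0 <= E x by case: x.
have cB : #|B| = t.
  by rewrite -sum1_card big_sumType /= sum1_card sum1_card card_ord.
have sB : \sum_(x in B) E x = \sum_(i in A) u i + e%:R.
  by rewrite big_sumType /= sumr_const card_ord.
have pB : \prod_(x in B) E x = \prod_(i in A) u i.
  by rewrite big_sumType /= big1_eq mulr1.
have [] := leif_AGM (fun x (_ : x \in B) => E0 x).
rewrite sB pB cB => h _; rewrite -(@ler_pXn2r _ t) ?nnegrE //; last 2 first.
- by apply: prodr_ge0 => i _; apply: powR_ge0.
- by rewrite divr_ge0 ?addr_ge0 ?sumr_ge0.
by rewrite -powR_prod // powR_invK // prodr_ge0.
Qed.

(** Each function is divided by its mean and [padded_AGM] is applied pointwise; functions outside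
    [A] are constant and have ratio 1. *)
Lemma generalized_holder (R : realType) (W I : finType) (mu : W -> R)
    (A : {pred I}) (g : I -> W -> R) t :
  (0 < t)%N -> (#|A| <= t)%N ->
  (forall w, 0 <= mu w) -> \sum_w mu w = 1 -> (forall i w, 0 <= g i w) ->
  (forall i w w', i \notin A -> g i w = g i w') ->
  \sum_w mu w * \prod_i g i w `^ (t%:R^-1) <=
  \prod_i (\sum_w mu w * g i w) `^ (t%:R^-1).
Proof.
move=> t0 At mu0 mu1 g0 gA; have tp : 0 < t%:R :> R by rewrite ltr0n.
pose m i := \sum_w mu w * g i w.
have mg0 i w : 0 <= mu w * g i w by rewrite mulr_ge0.
have m0 i : 0 <= m i by apply: sumr_ge0.
(* If some mean is 0, normalization is impossible, but every term on the left vanishes. *)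
have [/existsP[i /eqP mi]|] := boolP [exists i, m i == 0].
  rewrite big1 => [|w _]; first by apply: prodr_ge0 => j _; apply: powR_ge0.
  have /eqP : mu w * g i w = 0.
    by have/eqP := mi; rewrite psumr_eq0 // => /allP/(_ w (mem_index_enum w))/eqP.
  rewrite mulf_eq0 => /orP[/eqP->|/eqP gi]; first by rewrite mul0r.
  by rewrite (bigD1 i) //= gi powR0 ?mul0r ?mulr0 // invr_neq0 // gt_eqF.
rewrite negb_exists => /forallP mn0.
have mp i : 0 < m i by rewrite lt_neqAle eq_sym mn0 m0.
have u0 w i : 0 <= g i w / m i by rewrite divr_ge0.
have uA i w : i \notin A -> g i w / m i = 1.
  move=> iA; suff E : m i = g i w by rewrite -E divff.
  rewrite /m (eq_bigr (fun w' => mu w' * g i w)) -?mulr_suml ?mu1 ?mul1r // => w' _.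
  by rewrite (gA i w' w).
have E w : \prod_i g i w `^ t%:R^-1 =
    (\prod_i m i `^ t%:R^-1) * \prod_(i in A) (g i w / m i) `^ t%:R^-1.
  rewrite [X in _ * X]big_mkcond -big_split; apply: eq_bigr => i _ /=.
  rewrite -{1}(divfK (mn0 i) (g i w)) mulrC (powRM _ (m0 i) (u0 w i)).
  by case: ifPn => // iA; rewrite uA // powR1.
rewrite (eq_bigr (fun w => (\prod_i m i `^ t%:R^-1) *
    (mu w * \prod_(i in A) (g i w / m i) `^ t%:R^-1))) => [|w _]; last first.
  by rewrite E mulrCA.
rewrite -mulr_sumr ler_piMr ?prodr_ge0 // => [i _|]; first exact: powR_ge0.
apply: (@le_trans _ _ (\sum_w mu w *
    ((\sum_(i in A) g i w / m i + (t - #|A|)%:R) / t%:R))).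
  by apply: ler_sum => w _; rewrite ler_wpM2l // padded_AGM.
under eq_bigr do rewrite mulrA mulrDr.
rewrite -mulr_suml big_split /= -mulr_suml mu1 mul1r.
rewrite ler_pdivrMr // mul1r.
have -> : \sum_w mu w * \sum_(i in A) g i w / m i = #|A|%:R.
  under eq_bigr do rewrite mulr_sumr.
  rewrite exchange_big -sum1_card natr_sum; apply: eq_bigr => i _.
  under eq_bigr do rewrite mulrA.
  by rewrite -mulr_suml -/(m i) divff.
by rewrite -natrD subnKC.
Qed.

Section Finner.
Variables (R : realType) (k : nat) (W : finType) (pr : {set 'I_k} -> W -> R).
Hypothesis prD : distrs pr.
Notation rnd := {ffun {set 'I_k} -> W}.

Definition updr (S : {set 'I_k}) (r : rnd) (w : W) : rnd :=
  [ffun T => if T == S then w else r T].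

(** Conditional expectation given all strings but that of [S]. *)
Definition avg (S : {set 'I_k}) (G : rnd -> R) (r : rnd) : R :=
  \sum_w pr S w * G (updr S r w).

Definition expect (G : rnd -> R) : R := \sum_r prob_rand pr r * G r.

Lemma expect_avg S G : expect (avg S G) = expect G.
Proof.
pose H (r : rnd) w := prob_rand pr r * pr S w.
have HE (r : rnd) w : H (updr S r w) (r S) = H r w.
  rewrite /H /prob_rand (bigD1 S) //= [in RHS](bigD1 S) //= ffunE eqxx.
  rewrite mulrAC [in RHS]mulrAC [pr S w * _]mulrC; congr (_ * _).
  by apply: eq_bigr => T /negbTE ne; rewrite ffunE ne.
rewrite /expect /avg; transitivity (\sum_r \sum_w H r w * G (updr S r w)).
  by apply: eq_bigr => r _; rewrite mulr_sumr; apply: eq_bigr => w _; rewrite mulrA.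
transitivity (\sum_r \sum_w H r w * G r); last first.
  apply: eq_bigr => r _; rewrite -mulr_suml -mulr_sumr; case: prD => _ ->.
  by rewrite mulr1.
rewrite !pair_bigA /=.
pose h (p : rnd * W) := (updr S p.1 p.2, p.1 S).
have hK : involutive h.
  move=> [r w]; rewrite /h /= ffunE eqxx; congr pair; apply/ffunP => T.
  by rewrite !ffunE; case: eqP => // ->.
rewrite [RHS](reindex_inj (inv_inj hK)) /=; apply: eq_bigr => p _.
by rewrite HE.
Qed.

(* Finner's inequality, with weights [1 / t]: every random string is read by at
   most [t] of the functions. *)
Lemma finner t (D : 'I_k -> pred {set 'I_k}) (G : 'I_k -> rnd -> R) :
  (0 < t)%N -> (forall S, #|[pred i | D i S]| <= t)%N ->
  (forall i r, 0 <= G i r) ->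
  (forall i (r r' : rnd), (forall S, D i S -> r S = r' S) -> G i r = G i r') ->
  expect (fun r => \prod_i G i r `^ (t%:R^-1)) <=
  \prod_i (expect (G i)) `^ (t%:R^-1).
Proof.
move=> t0 Dt G0 GD; case: (prD) => p0 p1.
have sum1 : \sum_r prob_rand pr r = 1.
  by rewrite /prob_rand -(bigA_distr_bigA (fun S w => pr S w)) big1.
(* Induction on the list of strings not yet integrated out; [generalized_holder] removes one at a
   time. *)
have aux (L : seq {set 'I_k}) : forall G : 'I_k -> rnd -> R,
  (forall i r, 0 <= G i r) ->
  (forall i (r r' : rnd), (forall S, S \in L -> D i S -> r S = r' S) -> G i r = G i r') ->
  expect (fun r => \prod_i G i r `^ (t%:R^-1)) <=
  \prod_i (expect (G i)) `^ (t%:R^-1).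
  elim: L => [|S L IH] {G0 GD}G G0 GD.
    (* All functions are constant now. An outcome [r0] exists because the probabilities add up to
       1. *)
    have [r0 _|r_empty] := pickP {: rnd}; last first.
      by move: sum1; rewrite big1 => [/eqP|r]; [rewrite eq_sym oner_eq0|have := r_empty r].
    have Gc i r : G i r = G i r0 by apply: GD.
    have cst c : expect (fun=> c) = c by rewrite /expect -mulr_suml sum1 mul1r.
    have -> : expect (fun r => \prod_i G i r `^ t%:R^-1) =
        expect (fun=> \prod_i G i r0 `^ t%:R^-1).
      apply: eq_bigr => r _; congr (_ * _); apply: eq_bigr => i _.
      by rewrite (Gc i r).
    rewrite cst le_eqVlt; apply/orP; left; apply/eqP.
    apply: eq_bigr => i _; congr (_ `^ _); rewrite -[LHS]cst.
    by apply: eq_bigr => r _; rewrite (Gc i r).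
  apply: (@le_trans _ _ (expect (fun r => \prod_i (avg S (G i) r) `^ (t%:R^-1)))).
    rewrite -(expect_avg S); apply: ler_sum => r _.
    rewrite ler_wpM2l //; first by apply: prodr_ge0.
    apply: (generalized_holder (g := fun i w => G i (updr S r w)) t0 (Dt S)
      (p0 S) (p1 S)) => // i w w' iS.
    apply: GD => T TL DT; rewrite !ffunE; case: eqP => // TS.
    by move: iS; rewrite inE -TS DT.
  apply: le_trans (IH _ _ _) _.
  - by move=> i r; apply: sumr_ge0 => w _; rewrite mulr_ge0.
  - move=> i r r' h; apply: eq_bigr => w _; congr (_ * _); apply: GD => T.
    rewrite !ffunE inE; case: eqP => //= _; exact: h.
  - by under eq_bigr do rewrite expect_avg.
apply: (aux (enum {set 'I_k})) => // i r r' h; apply: GD => S; apply: h.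
by rewrite mem_enum.
Qed.

End Finner.

Lemma eq_incr (R : realType) n d (f g : bits n -> 'M[R[i]]_d) m x :
  f =1 g -> incr f m x = incr g m x.
Proof.
by move=> fg; rewrite /incr; congr (_ *: _); apply: eq_bigr => y _; rewrite fg.
Qed.

Lemma eq_sum_incr (R : realType) n d (f g : bits n -> 'M[R[i]]_d) m :
  f =1 g -> \sum_x trnorm (incr f m x) ^+ 2 = \sum_x trnorm (incr g m x) ^+ 2.
Proof. by move=> fg; apply: eq_bigr => x _; rewrite (eq_incr m x fg). Qed.

(** * Assembling the quantum lower bound *)

Section LowerBound.
Variables (R : realType) (k n t : nat) (P : qprot R k n).
Hypotheses (k3 : (3 <= k)%N) (n1 : (1 <= n)%N) (t2 : (2 <= t)%N).
Hypothesis tk : (t <= k - 1)%N.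
Hypotheses (Pv : qvalid (@t_shared k t) P) (Ps : qsolves P).

Definition info r (m : 'I_n) (i : 'I_k) : R :=
  (2 ^+ n)^-1 * \sum_x trnorm (incr (@qmx R k n P r i) m x) ^+ 2.

(* [A_i(m)] of the header. *)
Definition mean_info m i : R := expect (q_pr P) (fun r => info r m i).

Let N0 : 0 < 2 ^+ n :> R. Proof. by rewrite exprn_gt0. Qed.
Let t0 : (0 < t)%N. Proof. exact: ltnW t2. Qed.
Let tp : 0 < t%:R :> R. Proof. by rewrite ltr0n. Qed.
Let kp : 0 < k%:R :> R. Proof. by rewrite ltr0n (leq_trans _ k3). Qed.
Let np : 0 < n%:R :> R. Proof. by rewrite ltr0n. Qed.

Lemma info_ge0 r m i : 0 <= info r m i.
Proof.
rewrite mulr_ge0 ?invr_ge0 ?(ltW N0) //; apply: sumr_ge0 => x _.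
by rewrite sqr_ge0.
Qed.

Lemma info_le1 r m i : info r m i <= 1.
Proof.
have cst : 2 ^+ n = \sum_(x : bits n) 1 :> R by rewrite sumr_const card_bits natrX.
rewrite /info mulrC ler_pdivrMr // mul1r [leRHS]cst.
apply: ler_sum => x _; rewrite exprn_ile1 ?trnorm_ge0 //.
by apply: trnorm_incr_le1 => y; [exact: qmx_density Pv _ _ _ | exact: qmx_herm Pv _ _ _].
Qed.

Lemma mean_info_ge0 m i : 0 <= mean_info m i.
Proof.
by apply: sumr_ge0 => r _; rewrite mulr_ge0 ?info_ge0 ?(prob_rand_ge0 Pv).
Qed.

Lemma sum_mean_info i : \sum_m mean_info m i <= 8 * (q_len P i)%:R.
Proof.
rewrite /mean_info /expect exchange_big /=.
apply: (@le_trans _ _ (\sum_r prob_rand (q_pr P) r * (8 * (q_len P i)%:R))); last first.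
  by rewrite -mulr_suml (sum_prob_rand Pv) mul1r.
apply: ler_sum => r _; rewrite -mulr_sumr ler_wpM2l ?(prob_rand_ge0 Pv) //.
rewrite /info -mulr_sumr mulrC ler_pdivrMr // exchange_big /=.
by apply: random_access => x; [exact: qmx_density Pv _ _ _ | exact: qmx_herm Pv _ _ _ |
  exact: qmx_tr Pv _ _ _].
Qed.

(** Only members of [S] can read its string. If [S] has more than [t] elements, it is neither shared
    nor a singleton, so nobody does. *)
Lemma card_readable S : (#|[pred i | readable (@t_shared k t) i S]| <= t)%N.
Proof.
have [St|St] := leqP #|S| t.
  apply: leq_trans St; apply/subset_leq_card/subsetP => i.
  by rewrite inE => /orP[/andP[_ //]|/eqP->]; rewrite inE.
rewrite eq_card0 // => i; rewrite !inE /readable /t_shared gtn_eqF //=.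
by apply/negbTE; apply: contraTneq St => ->; rewrite cards1 -leqNgt ltnW.
Qed.

Lemma mean_bound_info m :
  mean_bound P m <= (\prod_i mean_info m i) `^ (t%:R^-1).
Proof.
rewrite powR_prod => [|i]; last exact: mean_info_ge0.
(* The power [t] cancels the root in Finner's inequality, whose left side becomes
   [mean_bound P m]. *)
pose G i r := Num.sqrt (info r m i) ^+ t.
have G0 i r : 0 <= G i r by rewrite exprn_ge0 ?sqrtr_ge0.
have GD i (r r' : {ffun {set 'I_k} -> q_Omega P}) :
    (forall S, readable (@t_shared k t) i S -> r S = r' S) -> G i r = G i r'.
  move=> h; have E x : qmx r i x = qmx r' i x.
    case: Pv => _ [_ [/(_ i x r r' h) hst _]].
    by apply/matrixP => a c; rewrite !mxE hst.
  exact: (congr1 (fun u => Num.sqrt ((2 ^+ n)^-1 * u) ^+ t) (eq_sum_incr m E)).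
have := finner Pv.1 t0 card_readable G0 GD.
have -> : expect (q_pr P) (fun r => \prod_i G i r `^ t%:R^-1) = mean_bound P m.
  apply: eq_bigr => r _; congr (_ * _); apply: eq_bigr => i _.
  by rewrite exprnK_powR ?sqrtr_ge0.
move=> /le_trans; apply; apply: ler_prod => i _; rewrite powR_ge0 /=.
have hE : expect (q_pr P) (G i) <= mean_info m i.
  apply: ler_sum => r _; rewrite ler_wpM2l ?(prob_rand_ge0 Pv) //.
  (* Here [t >= 2] enters: since [info] is at most 1, the power [t] of its square root is at most
     [info]. *)
  rewrite /G -(subnKC t2) exprD sqr_sqrtr ?info_ge0 // ler_piMr ?info_ge0 //.
  by rewrite exprn_ile1 ?sqrtr_ge0 // -sqrtr1 ler_wsqrtr // info_le1.
rewrite ge0_ler_powR ?invr_ge0 ?(ltW tp) ?nnegrE ?mean_info_ge0 //.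
by apply: sumr_ge0 => r _; rewrite mulr_ge0 ?G0 ?(prob_rand_ge0 Pv).
Qed.

(** Dividing by the message length limits every player to a contribution of at most 8 over all
    positions. For length 0 the quotient is 0. *)
Definition rel_info m : R := \sum_i mean_info m i / (q_len P i)%:R.

Lemma rel_info_ge0 m : 0 <= rel_info m.
Proof. by apply: sumr_ge0 => i _; rewrite divr_ge0 ?mean_info_ge0. Qed.

(** By Markov's inequality at most a quarter of the positions fail this: the threshold is four times
    the bound [8 * k] on the sum of [rel_info]. *)
Definition light : pred 'I_n := fun m => n%:R * rel_info m <= 32 * k%:R.

Lemma card_light : (2 * n < 3 * #|light|)%N.
Proof.
have h : \sum_m rel_info m <= 8 * k%:R.
  rewrite exchange_big /= mulrC mulr_natl -[k in leRHS]card_ord -sumr_const.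
  apply: ler_sum => i _; rewrite -mulr_suml.
  have [->|c0] := posnP (q_len P i); first by rewrite invr0 mulr0.
  by rewrite ler_pdivrMr ?ltr0n // sum_mean_info.
have h2 : #|[predC light]|%:R * (32 * k%:R) <= n%:R * (8 * k%:R) :> R.
  apply: le_trans (_ : n%:R * \sum_m rel_info m <= _); last by rewrite ler_pM2l.
  rewrite mulr_natl -sumr_const mulr_sumr [leRHS](bigID light) /= -[leLHS]add0r.
  apply: lerD; first by apply: sumr_ge0 => m _; rewrite mulr_ge0 ?rel_info_ge0.
  by apply: ler_sum => m; rewrite inE -ltNge => /ltW.
have h3 : (4 * #|[predC light]| <= n)%N.
  rewrite -(ler_nat R) natrM -(ler_pM2r kp); lra.
have hC : (#|light| + #|[predC light]| = n)%N by rewrite cardC card_ord.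
move: h3 hC; move: #|light| #|[predC light]| => u v h3 hC; lia.
Qed.

(** The arithmetic-geometric mean inequality is used twice: for the information per qubit, bounded
    by lightness, and for the message lengths, whose sum is the cost. *)
Lemma prod_mean_info_light m : light m ->
  \prod_i mean_info m i <= (32 * (qcost P)%:R / (n%:R * k%:R)) ^+ k.
Proof.
move=> hm.
have -> : \prod_i mean_info m i =
   (\prod_i (mean_info m i / (q_len P i)%:R)) * \prod_i (q_len P i)%:R.
  rewrite -big_split; apply: eq_bigr => i _ /=.
  (* A player who sends no qubits has zero information by [sum_mean_info], which makes up for the
     division by 0. *)
  have [c0|c0] := posnP (q_len P i); last by rewrite divfK // pnatr_eq0 -lt0n.
  rewrite c0 mulr0; apply/eqP; rewrite eq_le mean_info_ge0 andbT.
  have := sum_mean_info i; rewrite c0 mulr0; apply: le_trans.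
  by rewrite (bigD1 m) //= lerDl; apply: sumr_ge0 => j _; apply: mean_info_ge0.
have -> : 32 * (qcost P)%:R / (n%:R * k%:R) =
    (32 / n%:R) * ((qcost P)%:R / k%:R) :> R.
  by rewrite invfM mulrACA.
have AGM (E : 'I_k -> R) : (forall i, 0 <= E i) ->
    \prod_i E i <= ((\sum_i E i) / k%:R) ^+ k.
  move=> E0; have [] := @leif_AGM R 'I_k predT E (fun i _ => E0 i).
  by rewrite card_ord.
rewrite exprMn; apply: ler_pM.
- by apply: prodr_ge0 => i _; rewrite divr_ge0 ?mean_info_ge0.
- by apply: prodr_ge0.
- apply: le_trans (AGM _ _) _ => [i|]; first by rewrite divr_ge0 ?mean_info_ge0.
  rewrite lerXn2r ?nnegrE ?divr_ge0 ?rel_info_ge0 //.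
  by rewrite ler_pdivrMr // mulrAC ler_pdivlMr // mulrC.
- by apply: le_trans (AGM _ _) _; rewrite // /qcost natr_sum.
Qed.

(** The light positions give 1/6 <= n y^(k/t), whence y >= n^(-t/k) / 6. The constant 192 is 6 times
    the 32 in [y]. *)
Lemma quantum_lower_bound :
  1 / 192 * k%:R * (n%:R `^ (1 - t%:R / k%:R)) <= (qcost P)%:R :> R.
Proof.
set y : R := 32 * (qcost P)%:R / (n%:R * k%:R).
have y0 : 0 <= y by rewrite divr_ge0 ?mulr_ge0.
have h : 1 / 6 <= n%:R * y `^ (k%:R / t%:R).
  apply: le_trans (solving_bound Pv (ltnW k3) Ps card_light) _.
  apply: (@le_trans _ _ (\sum_(m | light m) y `^ (k%:R / t%:R))).
    apply: ler_sum => m hm; apply: le_trans (mean_bound_info m) _.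
    rewrite powRrM powR_mulrn // ge0_ler_powR ?invr_ge0 ?(ltW tp) ?nnegrE ?exprn_ge0 //.
      by apply: prodr_ge0 => i _; apply: mean_info_ge0.
    exact: prod_mean_info_light.
  rewrite sumr_const -[leLHS]mulr_natl ler_wpM2r ?powR_ge0 // ler_nat.
  by rewrite -[leqRHS]card_ord max_card.
have kt1 : 1 <= k%:R / t%:R :> R.
  by rewrite ler_pdivlMr // mul1r ler_nat (leq_trans tk) // leq_subr.
pose z : R := n%:R `^ (- (t%:R / k%:R)) / 6.
have z0 : 0 <= z by rewrite divr_ge0 ?powR_ge0.
have zy : z <= y.
  rewrite leNgt; apply/negP => yz.
  have h1 : y `^ (k%:R / t%:R) < z `^ (k%:R / t%:R).
    by rewrite gt0_ltr_powR ?nnegrE // (lt_le_trans _ kt1).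
  have h2 : z `^ (k%:R / t%:R) <= n%:R^-1 * (1 / 6).
    rewrite /z powRM ?powR_ge0 ?invr_ge0 // -powRrM.
    have -> : - (t%:R / k%:R) * (k%:R / t%:R) = -1 :> R.
      by rewrite mulNr mulrA divfK ?gt_eqF // divff // gt_eqF.
    rewrite powR_inv1 // ler_wpM2l ?invr_ge0 ?(ltW np) // mul1r.
    (* As k/t is at least 1, raising 1/6 to this power does not increase it. *)
    by rewrite ge1r_powR // invr_gt0 ltr0n /= invf_le1 ?ltr0n // ler1n.
  have : n%:R * y `^ (k%:R / t%:R) < 1 / 6.
    rewrite -[ltRHS](mulVKf (lt0r_neq0 np)) ltr_pM2l //.
    exact: lt_le_trans h1 h2.
  by rewrite ltNge h.
have -> : n%:R `^ (1 - t%:R / k%:R) = n%:R * n%:R `^ (- (t%:R / k%:R)) :> R.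
  rewrite powRD ?powRr1 ?(ltW np) //; apply/implyP => _; by rewrite gt_eqF.
move: zy; rewrite /z /y ler_pdivlMr ?mulr_gt0 //; lra.
Qed.

End LowerBound.

(** Reduces (c) to (b) with [t = 2]: messages that depend on private strings only are admissible
    under any sharing. *)
Lemma unshared_valid (R : realType) k n (P : qprot R k n) t :
  qvalid (@no_shared k) P -> qvalid (@t_shared k t) P.
Proof.
case=> hd [hden [hread hM]]; split=> //; split=> //; split=> // i x r r' h.
apply: hread => S /orP[//|Si]; apply: h; by rewrite /readable Si orbT.
Qed.

(** * Upper bound *)

(** Absorbing [phi] into the factor of [S] keeps the product form, and every other factor sums to
    1. *)
Lemma expect_single (R : realType) k (W : finType) (pr : {set 'I_k} -> W -> R)
    (S : {set 'I_k}) (phi : W -> R) : distrs pr ->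
  \sum_r prob_rand pr r * phi (r S) = \sum_w pr S w * phi w.
Proof.
case=> _ p1.
transitivity (\sum_(r : {ffun {set 'I_k} -> W})
  \prod_T (pr T (r T) * (if T == S then phi (r T) else 1))).
  apply: eq_bigr => r _; rewrite big_split /=; congr (_ * _).
  rewrite (bigD1 S) //= eqxx big1 ?mulr1 // => T /negbTE -> //.
rewrite -(bigA_distr_bigA (fun T w => pr T w * (if T == S then phi w else 1))).
rewrite (bigD1 S) //= [X in _ * X]big1 ?mulr1 => [|T /negbTE ne].
  by apply: eq_bigr => w _; rewrite eqxx.
by rewrite -[RHS](p1 T); apply: eq_bigr => w _; rewrite ne mulr1.
Qed.

(* The coordinate is optional so that a random string exists even for [n = 0]. *)
Definition xor_prot (R : realType) (k n : nat) (W : finType) (coord : W -> option 'I_n) :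
    cprot R k n :=
  CProt (fun _ _ => #|W|%:R^-1) (c_len := fun=> 1%N)
    (fun _ x r => [tuple oapp x false (coord (r [set: 'I_k]))])
    (fun m => (\big[addb/false]_(i < k) tnth (m i) ord0)%:R).

Lemma xor_prot_valid (R : realType) (k n : nat) (W : finType) (coord : W -> option 'I_n) :
  (0 < #|W|)%N -> cvalid (@unrestricted_shared k) (@xor_prot R k n W coord).
Proof.
move=> W0; split; [split|split].
- by move=> S w; rewrite invr_ge0.
- by move=> S; rewrite sumr_const -[LHS]mulr_natl divff // pnatr_eq0 -lt0n.
- move=> i x r r' h /=; rewrite (h setT) //.
  by rewrite /readable /unrestricted_shared eqxx inE.
- by move=> m /=; case: (\big[_/_]_(_ < _) _); rewrite ?ler01 ?lexx.
Qed.

(** The XOR of the messages is the entry of [xorall X] at a uniform position, so success has the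
    frequency of entries equal to the answer. *)
Lemma xor_prot_correct (R : realType) k n (X : 'I_k -> bits n) : (0 < n)%N ->
  cprob_correct (@xor_prot R k n 'I_n Some) X =
  n%:R^-1 * #|[set j | xorall X j == GP X]|%:R.
Proof.
move=> n0; have [hd _] := @xor_prot_valid R k n 'I_n Some ltac:(by rewrite card_ord).
have := expect_single [set: 'I_k] (fun j => (xorall X j == GP X)%:R) hd.
rewrite /= card_ord => E.
transitivity (\sum_r prob_rand (c_pr (@xor_prot R k n 'I_n Some)) r *
  (xorall X (r [set: 'I_k]) == GP X)%:R).
  apply: eq_bigr => r _; congr (_ * _) => /=.
  rewrite ffunE; under eq_bigr do rewrite (tnth_nth false) /=.
  by case: GP; case: (\big[_/_]_(_ < _) _); rewrite /= ?subrr ?subr0.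
rewrite -[RHS]/(_ * _) -sum1_card natr_sum.
have -> : \sum_(i in [set j | xorall X j == GP X]) 1 =
   \sum_j (xorall X j == GP X)%:R :> R.
  by rewrite big_mkcond; apply: eq_bigr => j _; rewrite inE; case: eqP.
rewrite mulr_sumr -E; apply: eq_bigr => r _; congr (_ * _).
by apply: eq_bigr => S _; rewrite /= card_ord.
Qed.

Lemma xor_prot_solves (R : realType) k n : (0 < n)%N ->
  csolves (@xor_prot R k n 'I_n Some).
Proof.
move=> n0 X hp; rewrite xor_prot_correct // [leRHS]mulrC ler_pdivlMr ?ltr0n //.
(* Under the promise, more than two thirds of the entries agree with the answer. *)
suff h : (2 * n <= 3 * #|[set j | xorall X j == GP X]|)%N.
  by move: h; rewrite -(ler_nat R) !natrM; lra.
have hc := cardsC [set j | xorall X j]; rewrite card_ord in hc.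
move: hp; rewrite /GP_promise /GP /hw.
case: (leqP n (2 * _)) => hG hp.
  have -> : [set j | xorall X j == true] = [set j | xorall X j].
    by apply/setP => j; rewrite !inE eqb_id.
  lia.
have -> : [set j | xorall X j == false] = ~: [set j | xorall X j].
  by apply/setP => j; rewrite !inE eqbF_neg.
lia.
Qed.

Theorem theorem2 :
  (* (a) one-bit-per-player classical protocol with shared randomness *)
  (forall (R : realType) (k n : nat), (3 <= k)%N ->
     exists P : cprot R k n,
       cvalid (@unrestricted_shared k) P /\ csolves P /\
       (forall i : 'I_k, c_len P i = 1%N) /\ ccost P = k)
  /\
  (* (b) Omega(k n^(1 - t/k)) with t-shared randomness, 2 <= t <= k-1 *)
  (exists c : rat, 0 < c /\
     forall (R : realType) (k n t : nat), (3 <= k)%N -> (1 <= n)%N ->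
       (2 <= t)%N -> (t <= k - 1)%N ->
       forall P : qprot R k n, qvalid (@t_shared k t) P -> qsolves P ->
         (ratr c : R) * k%:R * (n%:R `^ (1 - t%:R / k%:R)) <= (qcost P)%:R)
  /\
  (* (c) Omega(k n^(1 - 2/k)) without shared randomness *)
  (exists c : rat, 0 < c /\
     forall (R : realType) (k n : nat), (3 <= k)%N -> (1 <= n)%N ->
       forall P : qprot R k n, qvalid (@no_shared k) P -> qsolves P ->
         (ratr c : R) * k%:R * (n%:R `^ (1 - 2%:R / k%:R)) <= (qcost P)%:R).
Proof.
have ratrE (R : realType) : ratr (1 / 192%:R) = 1 / 192%:R :> R.
  by rewrite fmorph_div rmorph1 rmorph_nat.
split; [|split].
- move=> R k n k3; have cost_k (P : cprot R k n) :
      (forall i, c_len P i = 1%N) -> ccost P = k.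
    by move=> h; rewrite /ccost (eq_bigr _ (fun i _ => h i)) sum1_card card_ord.
  (* For [n = 0] the weight is 0, so no input satisfies the promise and only validity and cost are
     at stake. *)
  have [n0|n0] := posnP n.
    exists (@xor_prot R k n unit (fun=> None)); split.
      by apply: xor_prot_valid; rewrite card_unit.
    split.
      move=> X []; subst n; rewrite /hw.
      by have := max_card [set j | xorall X j]; rewrite card_ord; lia.
    by split=> //; apply: cost_k.
  exists (@xor_prot R k n 'I_n Some); split.
    by apply: xor_prot_valid; rewrite card_ord.
  by split; [exact: xor_prot_solves | split=> //; apply: cost_k].
- exists (1 / 192%:R); split; first by rewrite divr_gt0 // ltr0n.
  move=> R k n t k3 n1 t2 tk P Pv Ps.
  by rewrite ratrE; apply: quantum_lower_bound k3 n1 t2 tk Pv Ps.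
- exists (1 / 192%:R); split; first by rewrite divr_gt0 // ltr0n.
  move=> R k n k3 n1 P Pv Ps.
  rewrite ratrE; apply: (@quantum_lower_bound R k n 2 P) => //; first by lia.
  exact: unshared_valid.
Qed.
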